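(* Let $\{\Sigma_{(d)}\}_{d\ge1}$ be symmetric positive definite $d\times d$ matrices, $\Omega_{(d)}=\Sigma_{(d)}^{-1}$, satisfying the assumption below, and let $l>0$, $h=ld^{-1/2}$. For the RWM kernels targeting $\mathcal{N}_d(0,\Sigma_{(d)})$ with step size $h$, and for all $(x_1,y_1,v_1)\in\mathcal{S}$, the limit $$\lim_{d\to\infty}\sup_{\widetilde K\in\mathcal{I}}\mathbb{E}\Big[h^2Z_x^\top Z_yB_xB_y\ \Big|\ \tfrac{\lVert X_t\rVert^2_{\Omega_{(d)}^2}}{z_1^2d}=x_1,\ \tfrac{\lVert Y_t\rVert^2_{\Omega_{(d)}^2}}{z_1^2d}=y_1,\ \tfrac{\langle X_t,Y_t\rangle_{\Omega_{(d)}^2}}{z_1^2d}=v_1\Big]$$ is attained by the GCRN coupling, i.e. it equals the $d\to\infty$ limit of the same conditional expectation under the GCRN coupling.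
   Context: Notation: $\lVert x\rVert_A^2=x^\top Ax$, $\langle x,y\rangle_A=x^\top Ay$. Assumption: for $Z_{(d)}\sim\mathcal{N}_d(0,I_d)$ and each $k\in\mathbb{Z}$, $z_k^2=\lim_{d\to\infty}\lVert Z_{(d)}\rVert^2_{\Omega_{(d)}^k}/d$ exists in $L_2$ and $z_k\in(0,\infty)$. RWM updates: $X_{t+1}=X_t+hZ_xB_x$, $Y_{t+1}=Y_t+hZ_yB_y$ with $B_x=\mathbb{1}\{U_x\le\exp(-h\langle X_t,Z_x\rangle_{\Omega_{(d)}}-h^2\lVert Z_x\rVert^2_{\Omega_{(d)}}/2)\}$, analogously $B_y$; marginally $Z_x,Z_y\sim\mathcal{N}_d(0,I_d)$, $U_x,U_y\sim\mathrm{Unif}(0,1)$, $U_x$ independent of $Z_x$, $U_y$ independent of $Z_y$. A Markovian coupling couples $(U_x,Z_x)$ and $(U_y,Z_y)$ conditionally on $(X_t,Y_t)$; $\mathcal{I}$ is the class of such couplings in which $(U_x,U_y)$ is independent of $(Z_x,Z_y)$. GCRN coupling: $U_y=U_x$, $Z_x=Z-(n_x^\top Z)n_x+Z_1n_x$, $Z_y=Z-(n_y^\top Z)n_y+Z_1n_y$, with $n_x=-\Omega_{(d)}X_t/\lVert\Omega_{(d)}X_t\rVert$, $n_y=-\Omega_{(d)}Y_t/\lVert\Omega_{(d)}Y_t\rVert$, $Z\sim\mathcal{N}_d(0,I_d)$, $Z_1\sim\mathcal{N}(0,1)$ independent. $\mathcal{S}=\{(x,y,v):x,y\ge0,|v|\le\sqrt{xy}\}$.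 *)

(* Defs.v *)
From HB Require Import structures.
From mathcomp Require Import all_boot all_order all_algebra.
From mathcomp Require Import all_classical all_reals all_analysis.
Set Implicit Arguments. Unset Strict Implicit. Unset Printing Implicit Defensive.
Import Order.TTheory GRing.Theory Num.Theory.
Import numFieldNormedType.Exports.
Local Open Scope classical_set_scope.
Local Open Scope ring_scope.

Section RWMCoupling.
Variable R : realType.

(** Vectors of R^d are row vectors; random vectors take values in
    [d.-tuple R] (product sigma-algebra) and are converted with [rowt]. *)
Definition rowt (d : nat) (z : d.-tuple R) : 'rV[R]_d := \row_i tnth z i.

Definition bil (d : nat) (A : 'M[R]_d) (u v : 'rV[R]_d) : R := (u *m A *m v^T) 0 0.
Definition sqn (d : nat) (A : 'M[R]_d) (u : 'rV[R]_d) : R := bil A u u.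
Definition dotv (d : nat) (u v : 'rV[R]_d) : R := (u *m v^T) 0 0.
Definition enorm (d : nat) (u : 'rV[R]_d) : R := Num.sqrt (dotv u u).

Definition sym_pd (d : nat) (S : 'M[R]_d) : Prop :=
  S^T = S /\ forall u : 'rV[R]_d, u != 0 -> 0 < bil S u u.

Definition mpowz (d : nat) (A : 'M[R]_d) (k : int) : 'M[R]_d :=
  match k with
  | Posz n => iter n (mulmx A) 1%:M
  | Negz n => iter n.+1 (mulmx (invmx A)) 1%:M
  end.

Definition unif01_law d0 (T : measurableType d0) (P : probability T R) (U : T -> R) :=
  measurable_fun setT U /\
  forall A : set R, measurable A -> P (U @^-1` A) = uniform_prob (@ltr01 R) A.

Definition std_normal_law d0 (T : measurableType d0) (P : probability T R) (V : T -> R) :=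
  measurable_fun setT V /\
  forall A : set R, measurable A -> P (V @^-1` A) = normal_prob 0 1 A.

Definition std_gauss_law (d : nat) d0 (T : measurableType d0) (P : probability T R)
  (Z : T -> d.-tuple R) :=
  measurable_fun setT Z /\
  forall A : 'I_d -> set R, (forall i, measurable (A i)) ->
    P (Z @^-1` [set z | forall i, A i (tnth z i)]) = (\prod_(i < d) normal_prob 0 1 (A i))%E.

Record gvec (d : nat) := GVec {
  gv_disp : measure_display;
  gv_T : measurableType gv_disp;
  gv_P : probability gv_T R;
  gv_Z : gv_T -> d.-tuple R }.
Arguments gv_P {d} g.
Arguments gv_Z {d} g _.

(** a coupling of the innovations (U_x,Z_x), (U_y,Z_y) for one step, given (X_t,Y_t) *)
Record coupling (d : nat) := Coupling {
  cp_disp : measure_display;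
  cp_T : measurableType cp_disp;
  cp_P : probability cp_T R;
  cp_Ux : cp_T -> R;
  cp_Uy : cp_T -> R;
  cp_Zx : cp_T -> d.-tuple R;
  cp_Zy : cp_T -> d.-tuple R }.
Arguments cp_P {d} c.
Arguments cp_Ux {d} c _.
Arguments cp_Uy {d} c _.
Arguments cp_Zx {d} c _.
Arguments cp_Zy {d} c _.

Definition in_I (d : nat) (c : coupling d) : Prop :=
  let P := cp_P c in
  unif01_law P (cp_Ux c) /\ unif01_law P (cp_Uy c) /\
  std_gauss_law P (cp_Zx c) /\ std_gauss_law P (cp_Zy c) /\
      (forall (A : set R) (B : set (d.-tuple R)), measurable A -> measurable B ->
         P (cp_Ux c @^-1` A `&` cp_Zx c @^-1` B)
         = (P (cp_Ux c @^-1` A) * P (cp_Zx c @^-1` B))%E) /\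
      (forall (A : set R) (B : set (d.-tuple R)), measurable A -> measurable B ->
         P (cp_Uy c @^-1` A `&` cp_Zy c @^-1` B)
         = (P (cp_Uy c @^-1` A) * P (cp_Zy c @^-1` B))%E) /\
      (forall (A : set (R * R)) (B : set (d.-tuple R * d.-tuple R)),
         measurable A -> measurable B ->
         P ((fun w => (cp_Ux c w, cp_Uy c w)) @^-1` A
            `&` (fun w => (cp_Zx c w, cp_Zy c w)) @^-1` B)
         = (P ((fun w => (cp_Ux c w, cp_Uy c w)) @^-1` A)
            * P ((fun w => (cp_Zx c w, cp_Zy c w)) @^-1` B))%E).

Definition accept (d : nat) (Om : 'M[R]_d) (h : R) (x : 'rV[R]_d) (u : R)
  (z : d.-tuple R) : R :=
  if u <= expR (- (h * bil Om x (rowt z)) - h ^+ 2 * sqn Om (rowt z) / 2) then 1 else 0.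

Definition cross_expect (d : nat) (Om : 'M[R]_d) (h : R) (x y : 'rV[R]_d)
  (c : coupling d) : \bar R :=
  (\int[cp_P c]_w
     (h ^+ 2 * dotv (rowt (cp_Zx c w)) (rowt (cp_Zy c w))
      * accept Om h x (cp_Ux c w) (cp_Zx c w)
      * accept Om h y (cp_Uy c w) (cp_Zy c w))%:E)%E.

Definition sup_I (d : nat) (Om : 'M[R]_d) (h : R) (x y : 'rV[R]_d) : \bar R :=
  ereal_sup [set v : \bar R | exists c : coupling d, in_I c /\ v = cross_expect Om h x y c].

Definition nvec (d : nat) (Om : 'M[R]_d) (x : 'rV[R]_d) : 'rV[R]_d :=
  - ((enorm (x *m Om))^-1 *: (x *m Om)).

Definition is_GCRN (d : nat) (Om : 'M[R]_d) (x y : 'rV[R]_d) (c : coupling d) : Prop :=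
  let P := cp_P c in
  exists (U : cp_T c -> R) (Z : cp_T c -> d.-tuple R) (Z1 : cp_T c -> R),
  [/\ unif01_law P U, std_gauss_law P Z, std_normal_law P Z1,
      (forall (A : set R) (B : set (d.-tuple R)) (C : set R),
         measurable A -> measurable B -> measurable C ->
         P (U @^-1` A `&` Z @^-1` B `&` Z1 @^-1` C)
         = (P (U @^-1` A) * P (Z @^-1` B) * P (Z1 @^-1` C))%E) &
      forall w, [/\ cp_Ux c w = U w, cp_Uy c w = U w,
        rowt (cp_Zx c w) = rowt (Z w) - dotv (nvec Om x) (rowt (Z w)) *: nvec Om x
                           + Z1 w *: nvec Om x &
        rowt (cp_Zy c w) = rowt (Z w) - dotv (nvec Om y) (rowt (Z w)) *: nvec Om y
                           + Z1 w *: nvec Om y]].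

Definition assumption_z (Om : forall d, 'M[R]_d) (z : int -> R) : Prop :=
  forall k : int, 0 < z k /\
    forall G : forall d, gvec d,
      (forall d, std_gauss_law (gv_P (G d)) (gv_Z (G d))) ->
      (fun d => (\int[gv_P (G d)]_w
          (((sqn (mpowz (Om d) k) (rowt (gv_Z (G d) w)) / d%:R - z k ^+ 2) ^+ 2)%:E))%E)
        @ \oo --> 0%E.

Definition in_S (a b v : R) : Prop := [/\ 0 <= a, 0 <= b & `|v| <= Num.sqrt (a * b)].

End RWMCoupling.

(* Main.v *)
Require Import Defs.
From HB Require Import structures.
From mathcomp Require Import all_boot all_order all_algebra.
From mathcomp Require Import all_classical all_reals all_analysis.
From mathcomp Require Import measurable_realfun ring lra.
Import Order.TTheory GRing.Theory Num.Theory.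
Import numFieldNormedType.Exports.
Local Open Scope classical_set_scope.
Local Open Scope ring_scope.
Set Implicit Arguments.
Unset Strict Implicit.
Unset Printing Implicit Defensive.

(**
Since [h^2 Z_x^T Z_y] is asymptotically at most [l^2 z_0^2], only the probability that both
proposals are accepted matters. As the uniforms are independent of the Gaussians, that
probability is at most [E min(1, r_x, r_y)], where [r_x] is the acceptance ratio; up to
errors vanishing with [d], [r_x = exp(s_x G_x - k)] with [G_x = n_x^T Z_x] standard normal,
[s_x = l z_1 sqrt x_1] and [k = l^2 z_1^2 / 2]. The expectation of the minimum of two
nondecreasing functions of [G_x] and [G_y] is largest when [G_x = G_y], and this is what the
GCRN coupling achieves, together with [U_x = U_y]. Hence the common limit is
[l^2 z_0^2 E min(1, exp(s_x G - k), exp(s_y G - k))].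
*)

(** A member of [in_I] may correlate [Zx] and [Zy] arbitrarily, so the pair need not be jointly
    Gaussian and every upper estimate has to reduce to the two marginals. For the inner product this
    is u.v <= (|u|^2 + |v|^2) / 2; for the minimum of the two ratios it is a bound by a function of
    one normal component plus a function of the other. The remaining error depends on a single
    Gaussian law and not on the coupling, so one threshold in [d] serves the whole class and the
    supremum costs nothing. The inner product inequality is asymptotically sharp under GCRN: the two
    proposals differ only within the span of n_x and n_y, so E|Zx - Zy|^2 stays bounded while h^2 =
    l^2 / d. The exponents 0 and 1 of the assumption enter through |Z|^2 and through the quadratic
    term of the acceptance ratio. The linear term requires no limit: the conditioning fixes its
    scale h |Omega x| exactly. Rotation invariance of the Gaussian is used only as the resampling of
    one component, which follows from translations. *)

Section ImageLaw.
Context {R : realType} {d1 d2 : measure_display}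
  {T1 : measurableType d1} {T2 : measurableType d2}.
Local Open Scope ereal_scope.

Definition image_law (P : probability T1 R) (X : T1 -> T2)
    (mX : measurable_fun setT X) : probability T2 R :=
  let X' : {mfun T1 >-> T2} := HB.pack X (isMeasurableFun.Build _ _ _ _ X mX) in
  distribution P X'.

Lemma image_lawE (P : probability T1 R) (X : T1 -> T2)
  (mX : measurable_fun setT X) (A : set T2) : image_law P mX A = P (X @^-1` A).
Proof. by []. Qed.

Lemma ge0_integral_image_law (P : probability T1 R) (X : T1 -> T2)
    (mX : measurable_fun setT X) (f : T2 -> \bar R) :
  measurable_fun setT f -> (forall x, 0 <= f x) ->
  \int[image_law P mX]_x f x = \int[P]_w f (X w).
Proof. by move=> mf f0; rewrite ge0_integral_distribution. Qed.

Lemma eq_integral_law (P : probability T1 R) (X : T1 -> T2) (Q : probability T2 R)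
    (f : T2 -> \bar R) :
  measurable_fun setT X -> (forall A, measurable A -> P (X @^-1` A) = Q A) ->
  measurable_fun setT f -> (forall x, 0 <= f x) ->
  \int[P]_w f (X w) = \int[Q]_x f x.
Proof.
move=> mX PXQ mf f0; rewrite -(ge0_integral_image_law P mX mf f0).
by apply: eq_measure_integral => A mA _; exact: PXQ.
Qed.

Lemma integral_probability_cst (P : probability T1 R) (r : \bar R) :
  \int[P]__ r = r.
Proof.
rewrite integral_cst//.
by rewrite [X in _ * X](_ : _ = 1) ?mule1//; exact: probability_setT.
Qed.

End ImageLaw.
Global Opaque image_law.

(** * The standard Gaussian measure *)

Section StandardNormal.
Variable R : realType.
Local Notation mu := (@lebesgue_measure R).
Local Open Scope ereal_scope.

Lemma measurable_measurableTypeR :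
  measurable_fun [set: measurableTypeR R] (id : measurableTypeR R -> R).
Proof. by move=> _ A mA; rewrite setTI. Qed.

(* [normal_prob] lives on [measurableTypeR R]; this is its copy on [R]. *)
Definition stdnormal : probability R R :=
  image_law (@normal_prob R 0 1) measurable_measurableTypeR.

Local Notation gamma := stdnormal.

(** Translation preserves the length of half-open intervals, and these determine the Lebesgue
    measure. *)
Lemma integral_lebesgue_shift (a : R) (f : R -> \bar R) :
  measurable_fun setT f -> (forall x, 0 <= f x) ->
  \int[mu]_x f (x + a)%R = \int[mu]_x f x.
Proof.
move=> mf f0.
pose phi := ((fun x : R => x + a)%R : measurableTypeR R -> measurableTypeR R).
have mphi : measurable_fun setT phi by exact: measurable_funD.
have muE A : measurable A -> mu A = pushforward mu phi A.
  apply: lebesgue_measure_unique => _ [[u v] /= uv <-].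
  have -> : pushforward mu phi `]u, v]%classic = mu `](u - a)%R, (v - a)%R]%classic.
    rewrite /pushforward; congr (mu _); apply/seteqP; split => x /=;
      rewrite !in_itv/= ltrBlDr lerBrDr //.
  rewrite !lebesgue_measure_itv/= !lte_fin ltrD2r; case: ifP => // _.
  by rewrite -!EFinB; congr EFin; ring.
transitivity (\int[pushforward mu phi]_x f x).
  by rewrite ge0_integral_pushforward.
by apply: eq_measure_integral => A mA _; apply/esym; exact: muE.
Qed.

(** The Radon-Nikodym derivative agrees almost everywhere with the explicit density, since both
    integrate to [normal_prob] over every measurable set. *)
Lemma integral_normal01 (f : R -> \bar R) :
  measurable_fun setT f -> (forall x, 0 <= f x) ->
  \int[gamma]_x f x = \int[mu]_x (f x * (normal_pdf 0 1 x)%:E).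
Proof.
move=> mf f0; rewrite ge0_integral_image_law//=.
have dom := @normal_prob_dominates R 0 1.
rewrite -(Radon_Nikodym_SigmaFinite.change_of_variables dom f0 measurableT mf).
apply: ae_eq_integral => //.
- apply: emeasurable_funM => //.
  exact: measurable_int (Radon_Nikodym_SigmaFinite.f_integrable dom).
- apply: emeasurable_funM => //; apply/measurable_EFinP.
  exact: measurable_normal_pdf.
apply: ae_eqe_mul2l; apply: integral_ae_eq => //.
- exact: Radon_Nikodym_SigmaFinite.f_integrable.
- by apply/measurable_EFinP; exact: measurable_normal_pdf.
- by move=> A _ mA; rewrite -Radon_Nikodym_SigmaFinite.f_integral.
Qed.

(** One-dimensional Cameron-Martin formula: completing the square in the density at t - a produces
    the exponential factor. *)
Lemma normal01_translate (a : R) (f : R -> \bar R) :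
  measurable_fun setT f -> (forall x, 0 <= f x) ->
  \int[gamma]_t f (t + a)%R = \int[gamma]_t (f t * (expR (a * t - a ^+ 2 / 2))%:E).
Proof.
move=> mf f0.
have mexp : measurable_fun setT (fun t : R => expR (a * t - a ^+ 2 / 2)).
  apply: measurableT_comp => //; apply: measurable_funD => //.
have mg : measurable_fun setT (fun t : R => f t * (expR (a * t - a ^+ 2 / 2))%:E).
  by apply: emeasurable_funM => //; exact/measurable_EFinP.
have mpdf : measurable_fun setT (fun t : R => (normal_pdf 0 1 t)%:E).
  by apply/measurable_EFinP; exact: measurable_normal_pdf.
rewrite integral_normal01 //; last exact/measurableT_comp/measurable_funD.
rewrite integral_normal01 //; last by move=> x; rewrite mule_ge0// lee_fin expR_ge0.
rewrite -(integral_lebesgue_shift (- a)%R) /=.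
- apply: eq_integral => x _; rewrite subrK -muleA; congr (_ * _).
  rewrite -EFinM; congr EFin; rewrite !normal_pdfE ?oner_neq0// /normal_fun.
  by rewrite mulrCA -expRD; congr (_ * expR _)%R; field.
- apply: emeasurable_funM => //; exact/measurableT_comp/measurable_funD.
- by move=> x; rewrite mule_ge0// lee_fin normal_pdf_ge0.
Qed.

Lemma normal01_mgf (a : R) : \int[gamma]_t (expR (a * t - a ^+ 2 / 2))%:E = 1.
Proof.
have := @normal01_translate a (cst 1) (measurable_cst _) (fun=> lee01).
rewrite /= integral_probability_cst => ->.
by apply: eq_integral => t _; rewrite mul1e.
Qed.

Lemma measurable_expR_affine (a b : R) :
  measurable_fun setT (fun t : R => expR (a * t - b)).
Proof.
by apply: measurableT_comp => //; apply: measurable_funD => //; exact: mulrl_measurable.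
Qed.

Lemma normal01_moment2 : \int[gamma]_t (t ^+ 2)%:E < +oo.
Proof.
pose e (a t : R) := expR (a * t - a ^+ 2 / 2).
have me a : measurable_fun setT (e a) by exact: measurable_expR_affine.
(* The factor [expR (1 / 2)] cancels the normalisation in [e 1] and [e (- 1)]; the 4 comes from
   squaring |t| / 2 <= exp(|t| / 2), which gives t^2 <= 4 (e^t + e^-t). *)
pose K : R := (4 * expR (1 / 2))%R.
have K0 : (0 <= K)%R by rewrite mulr_ge0// expR_ge0.
apply: (@le_lt_trans _ _ (\int[gamma]_t (K%:E * ((e 1 t)%:E + (e (- 1) t)%:E)))).
  apply: ge0_le_integral => //.
  - by move=> t _; rewrite lee_fin sqr_ge0.
  - by apply/measurable_EFinP; exact: exprn_measurable.
  - apply: measurable_funeM; apply: emeasurable_funD; exact/measurable_EFinP.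
  - move=> t _; rewrite -EFinD -EFinM lee_fin /e.
    rewrite -mulrA mulrDr -!expRD sqrrN expr1n mul1r mulN1r.
    rewrite (_ : 2^-1 + (1 * t - 2^-1) = t)%R; last by ring.
    rewrite (_ : 2^-1 + (- t - 2^-1) = - t)%R; last by ring.
    have h1 := expR_ge1Dx (t / 2); have h2 := expR_ge1Dx (- (t / 2)).
    rewrite (_ : t = t / 2 + t / 2)%R; last by field.
    rewrite opprD !expRD; move: h1 h2 (expR_ge0 (t / 2)%R) (expR_ge0 (- (t / 2))%R).
    move: (expR (t / 2)%R) (expR (- (t / 2))%R) => p q.
    by case: (leP 0 (t / 2))%R => ? *; nra.
rewrite ge0_integralZl//=; last 2 first.
- by apply: emeasurable_funD; exact/measurable_EFinP.
- by move=> t _; rewrite adde_ge0// lee_fin expR_ge0.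
rewrite ge0_integralD//=; first by rewrite !normal01_mgf -EFinD -EFinM ltry.
- by move=> t _; rewrite lee_fin expR_ge0.
- exact/measurable_EFinP.
- by move=> t _; rewrite lee_fin expR_ge0.
- exact/measurable_EFinP.
Qed.

End StandardNormal.

(** * The Gaussian measure on tuples and its characterisation by boxes *)

Section StandardGaussian.
Variable R : realType.
Local Notation gamma := (stdnormal R).
Local Open Scope ereal_scope.

Lemma measurable_consp d :
  measurable_fun setT (fun p : R * d.-tuple R => [tuple of p.1 :: p.2]).
Proof. exact: measurable_cons. Qed.

(** Built one coordinate at a time, so that Tonelli turns statements about it into inductions on the
    dimension. *)
Fixpoint gauss (d : nat) : probability (d.-tuple R) R :=
  match d with
  | 0 => image_law gamma (measurable_cst [tuple])
  | d'.+1 => image_law (gamma \x gauss d')%E (@measurable_consp d')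
  end.

Lemma ge0_integral_gauss0 (f : 0.-tuple R -> \bar R) :
  measurable_fun setT f -> (forall z, 0 <= f z) ->
  \int[gauss 0]_z f z = f [tuple].
Proof.
by move=> mf f0; rewrite ge0_integral_image_law//= integral_probability_cst.
Qed.

Lemma ge0_integral_gaussS d (f : d.+1.-tuple R -> \bar R) :
  measurable_fun setT f -> (forall z, 0 <= f z) ->
  \int[gauss d.+1]_z f z =
  \int[gamma]_t \int[gauss d]_z f [tuple of t :: z].
Proof.
move=> mf f0; rewrite ge0_integral_image_law// fubini_tonelli1//=.
by apply: (measurableT_comp mf); exact: measurable_consp.
Qed.

Lemma measurable_box d (A : 'I_d -> set R) : (forall i, measurable (A i)) ->
  measurable [set z : d.-tuple R | forall i, A i (tnth z i)].
Proof.
move=> mA.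
have -> : [set z : d.-tuple R | forall i, A i (tnth z i)] =
    \bigcap_(i in [set: 'I_d]) ((fun z => tnth z i) @^-1` A i).
  by apply/seteqP; split => z /= h i; [move=> _|]; exact: h.
apply: fin_bigcap_measurable => // i _; rewrite -[X in measurable X]setTI.
exact: measurable_tnth.
Qed.

Lemma gauss_box d (A : 'I_d -> set R) : (forall i, measurable (A i)) ->
  gauss d [set z | forall i, A i (tnth z i)] = \prod_(i < d) gamma (A i).
Proof.
elim: d A => [|d IH] A mA.
  rewrite big_ord0 image_lawE [X in gamma X](_ : _ = setT) ?probability_setT//.
  by apply/seteqP; split => // z _ [].
rewrite big_ord_recl -IH// image_lawE.
rewrite -product_measure1E//; last first.
  exact: (@measurable_box d (fun i => A (lift ord0 i))).
set B := (X in _ = _ X); rewrite [X in _ X = _](_ : _ = B)//.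
apply/seteqP; split => -[t z] /=.
  move=> h; split; first by have := h ord0; rewrite tnth0.
  by move=> i; have := h (lift ord0 i); rewrite tnthS.
move=> [h0 h1] i; case: (unliftP ord0 i) => [j ->|->]; last by rewrite tnth0.
by rewrite tnthS; exact: h1.
Qed.

Lemma measurable_tuple_boxes d :
  @measurable _ (d.-tuple R) = <<s [set B | exists A : 'I_d -> set R,
    (forall i, measurable (A i)) /\ B = [set z | forall i, A i (tnth z i)]] >>.
Proof.
apply/seteqP; split; last first.
  apply: smallest_sub; first exact: sigma_algebra_measurable.
  by move=> _ [A [mA ->]]; exact: measurable_box.
apply: smallest_sub; first exact: smallest_sigma_algebra.
rewrite -bigcup_seq/= => _ [i _] [A mA <-]; rewrite setTI.
apply: sub_sigma_algebra; exists (fun j => if j == i then A else setT); split.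
  by move=> j; case: ifP.
apply/seteqP; split => z /=.
  by move=> Az j; case: eqP => // ->.
by move=> /(_ i); rewrite eqxx.
Qed.

(** [std_gauss_law] prescribes probabilities of boxes only; boxes are stable under intersection and
    generate the sigma-algebra, so they determine the whole law. *)
Lemma std_gauss_law_gauss d d0 (T : measurableType d0) (P : probability T R)
    (Z : T -> d.-tuple R) : std_gauss_law P Z ->
  forall A, measurable A -> P (Z @^-1` A) = gauss d A.
Proof.
move=> [mZ PZ] A mA; rewrite -(image_lawE P mZ).
apply: (@measure_unique _ _ _ _ (fun=> setT) (measurable_tuple_boxes d)) mA.
- move=> _ _ [A1 [mA1 ->]] [A2 [mA2 ->]].
  exists (fun i => A1 i `&` A2 i); split; first by move=> i; exact: measurableI.
  apply/seteqP; split => z /=; first by move=> [h1 h2] i; split.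
  by move=> h; split => i; have [] := h i.
- move=> _; exists (fun=> setT); split => //; exact/seteqP.
- by apply/seteqP; split => // z _; exists 0%N.
- move=> _ [B [mB ->]]; rewrite [LHS]image_lawE [LHS]PZ// [RHS]gauss_box//.
- by move=> _; rewrite (le_lt_trans (probability_le1 _ _)) ?ltry.
Qed.

Lemma gauss_std_gauss_law d : std_gauss_law (gauss d) id.
Proof. by split => // A mA; rewrite preimage_id gauss_box. Qed.

End StandardGaussian.
Global Opaque gauss.

(** * Translations of the Gaussian and resampling along a direction *)

Section Translation.
Variable R : realType.
Local Notation gamma := (stdnormal R).
Local Notation gauss := (gauss R).
Local Open Scope ereal_scope.

Definition tshift d (a : 'I_d -> R) (z : d.-tuple R) : d.-tuple R :=
  [tuple (tnth z i + a i)%R | i < d].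

Definition tdot d (a : 'I_d -> R) (z : d.-tuple R) : R :=
  (\sum_(i < d) a i * tnth z i)%R.

Lemma measurable_tdot d (a : 'I_d -> R) : measurable_fun setT (tdot a).
Proof.
apply: measurable_sum => i; apply: measurable_funM => //; exact: measurable_tnth.
Qed.

Lemma measurable_tshift d d0 (T : measurableType d0) (Z : T -> d.-tuple R)
    (A : 'I_d -> T -> R) :
  measurable_fun setT Z -> (forall i, measurable_fun setT (A i)) ->
  measurable_fun setT (fun w => tshift (A^~ w) (Z w)).
Proof.
move=> mZ mA; apply/measurable_fun_tnthP => i.
rewrite (_ : _ \o _ = fun w => (tnth (Z w) i + A i w)%R); last first.
  by apply/funext => w /=; rewrite tnth_mktuple.
by apply: measurable_funD => //; exact: (measurableT_comp (measurable_tnth i) mZ).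
Qed.

Lemma tshift_cons d (a : 'I_d.+1 -> R) t (z : d.-tuple R) :
  tshift a [tuple of t :: z] =
  [tuple of (t + a ord0)%R :: tshift (fun i => a (lift ord0 i)) z].
Proof.
apply: eq_from_tnth => i; rewrite tnth_mktuple.
case: (unliftP ord0 i) => [j ->|->]; last by rewrite !tnth0.
by rewrite !tnthS tnth_mktuple.
Qed.

Lemma tdot_cons d (a : 'I_d.+1 -> R) t (z : d.-tuple R) :
  tdot a [tuple of t :: z] = (a ord0 * t + tdot (fun i => a (lift ord0 i)) z)%R.
Proof.
rewrite /tdot big_ord_recl tnth0; congr +%R.
by apply: eq_bigr => i _; rewrite tnthS.
Qed.

(** Cameron-Martin density of the Gaussian shifted by [a] with respect to the centred one. *)
Definition cmdens d (a : 'I_d -> R) (z : d.-tuple R) : R :=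
  expR (tdot a z - (\sum_(i < d) a i ^+ 2) / 2).

Lemma measurable_cmdens d (a : 'I_d -> R) : measurable_fun setT (cmdens a).
Proof.
apply: measurableT_comp => //; apply: measurable_funD => //; exact: measurable_tdot.
Qed.

(** The density factorises over coordinates, so the one-dimensional formula handles the head and the
    induction hypothesis the tail. *)
Lemma gauss_translate d (a : 'I_d -> R) (f : d.-tuple R -> \bar R) :
  measurable_fun setT f -> (forall z, 0 <= f z) ->
  \int[gauss d]_z f (tshift a z) = \int[gauss d]_z (f z * (cmdens a z)%:E).
Proof.
elim: d a f => [|d IH] a f mf f0.
  have mcm := @measurable_cmdens 0 a.
  rewrite !ge0_integral_gauss0 //.
  - rewrite /cmdens /tdot !big_ord0 mul0r subrr expR0 mule1; congr f.
    by apply: eq_from_tnth => -[].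
  - by apply: emeasurable_funM => //; exact/measurable_EFinP.
  - by move=> z; rewrite mule_ge0// lee_fin expR_ge0.
  - apply: measurableT_comp => //.
    exact: (@measurable_tshift _ _ _ id (fun i _ => a i)).
pose a' i := a (lift ord0 i).
have mcons t : measurable_fun setT (fun z : d.-tuple R => [tuple of t :: z]).
  exact: measurable_cons.
have mG : measurable_fun setT (fun p : R * d.-tuple R =>
    f [tuple of p.1 :: p.2] * (cmdens a' p.2)%:E).
  apply: emeasurable_funM; first by apply: (measurableT_comp mf); exact: measurable_consp.
  by apply/measurable_EFinP; apply: (measurableT_comp (@measurable_cmdens _ a')).
pose F t := \int[gauss d]_z (f [tuple of t :: z] * (cmdens a' z)%:E).
have mF : measurable_fun setT F.
  apply: (@measurable_fun_fubini_tonelli_F _ _ _ _ _ (gauss d) _ mG) => -[t z] /=.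
  by rewrite mule_ge0// lee_fin expR_ge0.
have F0 t : 0 <= F t.
  by apply: integral_ge0 => z _; rewrite mule_ge0// lee_fin expR_ge0.
have mfs : measurable_fun setT (fun z => f (tshift a z)).
  apply: measurableT_comp => //.
  exact: (@measurable_tshift _ _ _ id (fun i _ => a i)).
have mfc : measurable_fun setT (fun z => f z * (cmdens a z)%:E).
  apply: emeasurable_funM => //; apply/measurable_EFinP; exact: measurable_cmdens.
have fc0 z : 0 <= f z * (cmdens a z)%:E by rewrite mule_ge0// lee_fin expR_ge0.
rewrite (ge0_integral_gaussS mfs (fun=> f0 _)) (ge0_integral_gaussS mfc fc0).
transitivity (\int[gamma]_t F (t + a ord0)%R).
  apply: eq_integral => t _.
  under eq_integral do rewrite tshift_cons.
  by rewrite (IH a' (fun z => f [tuple of (t + a ord0)%R :: z])) //; exact: measurableT_comp.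
apply: (etrans (normal01_translate _ mF F0)); apply: eq_integral => t _.
rewrite -ge0_integralZr; [|exact: measurableT| | |].
- apply: eq_integral => z _; rewrite -muleA -EFinM; congr (_ * _%:E).
  rewrite /cmdens tdot_cons big_ord_recl -expRD; congr expR; rewrite /a'; ring.
- apply: emeasurable_funM; first exact: measurableT_comp.
  apply/measurable_EFinP; exact: measurable_cmdens.
- by move=> z _; rewrite mule_ge0// lee_fin expR_ge0.
- by rewrite lee_fin expR_ge0.
Qed.

Lemma tdot_tshift d (n : 'I_d -> R) (t : R) (z : d.-tuple R) :
  (\sum_(i < d) n i ^+ 2 = 1)%R ->
  tdot n (tshift (fun i => t * n i)%R z) = (tdot n z + t)%R.
Proof.
move=> n1; rewrite /tdot -[X in (_ + X)%R]mulr1 -n1 mulr_sumr -big_split/=.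
by apply: eq_bigr => i _; rewrite tnth_mktuple; ring.
Qed.

(* The map [(z, t) |-> (z + (t - n.z) n, n.z)] is an orthogonal reflection, hence
   preserves the Gaussian measure. It is a composition of shears, so that only
   translations (in [t] for fixed [z], then in [z] for fixed [t]) are needed. *)
Lemma gauss_replace_direction d (n : 'I_d -> R) (f : d.-tuple R -> \bar R) :
  (\sum_(i < d) n i ^+ 2 = 1)%R ->
  measurable_fun setT f -> (forall z, 0 <= f z) ->
  \int[gauss d]_z \int[gamma]_t f (tshift (fun i => (t - tdot n z) * n i)%R z) =
  \int[gauss d]_z f z.
Proof.
move=> n1 mf f0.
(* [e] is the density created by translating t by - n.z at fixed z; [e'] is the total density after
   z has in turn been translated along n at fixed t. At that stage f no longer involves t, and [e']
   integrates to 1 in t by the normal generating function. *)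
pose e (p : d.-tuple R * R) := expR (- tdot n p.1 * p.2 - (- tdot n p.1) ^+ 2 / 2).
pose e' (p : d.-tuple R * R) := expR (tdot n p.1 * p.2 - (tdot n p.1) ^+ 2 / 2).
have mn : measurable_fun setT (fun p : d.-tuple R * R => tdot n p.1).
  by apply: (measurableT_comp (@measurable_tdot _ n)).
have me : measurable_fun setT e.
  apply: measurableT_comp => //; apply: measurable_funB.
    by apply: measurable_funM => //; exact: measurableT_comp.
  by apply: measurable_funM => //; apply: measurable_funX; exact: measurableT_comp.
have me' : measurable_fun setT e'.
  apply: measurableT_comp => //; apply: measurable_funB.
    by apply: measurable_funM.
  by apply: measurable_funM => //; apply: measurable_funX.
have mS : measurable_fun setT (fun p : d.-tuple R * R =>
    f (tshift (fun i => p.2 * n i)%R p.1)).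
  apply: measurableT_comp => //.
  apply: (@measurable_tshift _ _ _ (fun p : d.-tuple R * R => p.1)
    (fun i (p : d.-tuple R * R) => p.2 * n i)%R); first exact: measurable_fst.
  by move=> i; exact: measurable_funM.
have mt (g : d.-tuple R * R -> \bar R) z : measurable_fun setT g ->
    measurable_fun setT (fun t => g (z, t)).
  by move=> mg; apply: (measurableT_comp mg); exact: measurable_fun_pair.
transitivity (\int[gauss d]_z \int[gamma]_t
    (f (tshift (fun i => t * n i)%R z) * (e (z, t))%:E)).
  apply: eq_integral => z _.
  have mfz := mt _ z mS.
  exact: (@normal01_translate R (- tdot n z)%R _ mfz (fun=> f0 _)).
rewrite (@fubini_tonelli _ _ _ _ _ (gauss d) gamma
  (fun p => f (tshift (fun i => p.2 * n i)%R p.1) * (e p)%:E)); last 2 first.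
- by apply: emeasurable_funM => //; exact/measurable_EFinP.
- by move=> p; rewrite mule_ge0// lee_fin expR_ge0.
transitivity (\int[gamma]_t \int[gauss d]_z (f z * (e' (z, t))%:E)).
  apply: eq_integral => t _.
  (* The integrand rewritten as a function of the shifted point, the form required by
     [gauss_translate]; the shift is undone inside [e]. *)
  pose g z := f z * (e (tshift (fun i => - t * n i)%R z, t))%:E.
  have gE z : f (tshift (fun i => t * n i)%R z) * (e (z, t))%:E =
              g (tshift (fun i => t * n i)%R z).
    have tK : tshift (fun i => - t * n i)%R (tshift (fun i => t * n i)%R z) = z.
      by apply: eq_from_tnth => i; rewrite !tnth_mktuple; ring.
    by rewrite /g tK.
  transitivity (\int[gauss d]_z g (tshift (fun i => t * n i)%R z)).
    by apply: eq_integral => z _; exact: gE.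
  rewrite gauss_translate.
  - apply: eq_integral => z _; rewrite /g -muleA -EFinM; congr (_ * _%:E).
    rewrite /e /e' /cmdens -expRD/= tdot_tshift//; congr expR.
    have -> : tdot (fun i => t * n i)%R z = (t * tdot n z)%R.
      by rewrite /tdot mulr_sumr; apply: eq_bigr => i _; rewrite mulrA.
    under eq_bigr do rewrite exprMn.
    by rewrite -mulr_sumr n1; field.
  - apply: emeasurable_funM => //; apply/measurable_EFinP.
    apply: (measurableT_comp me); apply: measurable_fun_pair => //.
    exact: (@measurable_tshift _ _ _ id (fun i _ => (- t * n i)%R)).
  - by move=> z; rewrite mule_ge0// lee_fin expR_ge0.
rewrite -(@fubini_tonelli _ _ _ _ _ (gauss d) gamma (fun p => f p.1 * (e' p)%:E)); last 2 first.
- apply: emeasurable_funM; last exact/measurable_EFinP.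
  exact: (measurableT_comp mf).
- by move=> p; rewrite mule_ge0// lee_fin expR_ge0.
apply: eq_integral => z _ /=.
rewrite ge0_integralZl//=.
- rewrite (eq_integral (fun t => (expR (tdot n z * t - tdot n z ^+ 2 / 2))%:E)).
    by rewrite normal01_mgf mule1.
  by move=> t _; rewrite /e'.
- by apply: (mt (fun p => (e' p)%:E) z); exact/measurable_EFinP.
- by move=> t _; rewrite lee_fin expR_ge0.
Qed.

End Translation.

(** * Independence and uniform thresholds *)

Section Independence.
Context {R : realType} {d0 : measure_display} {T : measurableType d0}.
Variable P : probability T R.
Local Open Scope ereal_scope.

Lemma measure_eq_rectangles d1 d2 (T1 : measurableType d1) (T2 : measurableType d2)
    (m1 m2 : {measure set (T1 * T2)%type -> \bar R}) :
  m1 setT < +oo ->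
  (forall A B, measurable A -> measurable B -> m1 (A `*` B) = m2 (A `*` B)) ->
  forall X, measurable X -> m1 X = m2 X.
Proof.
move=> m1oo m12 X mX.
apply: (@measure_unique _ _ _ _ (fun=> setT) (measurable_prod_measurableType T1 T2)) mX.
- move=> _ _ [A1 mA1 [B1 mB1 <-]] [A2 mA2 [B2 mB2 <-]].
  exists (A1 `&` A2); first exact: measurableI.
  exists (B1 `&` B2); first exact: measurableI.
  by rewrite setXI.
- by move=> _; exists setT => //; exists setT => //; rewrite setXTT.
- by apply/seteqP; split => // z _; exists 0%N.
- by move=> _ [A mA [B mB <-]]; exact: m12.
- by [].
Qed.

Lemma uniform_prob_le (v : R) :
  uniform_prob (@ltr01 R) [set u | (u <= v)%R] = (Num.max 0 (Num.min 1 v))%:E.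
Proof.
rewrite /uniform_prob integral_uniform_pdf.
rewrite (_ : _ `&` _ = [set` `[0%R, Num.min 1%R v]]); last first.
  apply/seteqP; split => u /=; rewrite !in_itv/= le_min.
    by move=> [-> /andP[-> ->]].
  by move=> /and3P[-> -> ->].
rewrite (eq_integral (cst 1)); last first.
  move=> u; rewrite inE/= in_itv/= le_min /uniform_pdf => /and3P[-> -> _] /=.
  by rewrite subr0 invr1.
rewrite integral_cst//= mul1e lebesgue_measure_itv/= lte_fin sube0.
by rewrite maxEle leNgt; case: ltP => //= h; case: ltgtP h => // ->.
Qed.

(** The joint law is a product, so U can be integrated out at fixed V = v, giving P(U <= v) = min(1,
    v) when v >= 0. *)
Lemma uniform_le_indep (U V : T -> R) :
  unif01_law P U -> measurable_fun setT V -> (forall w, 0 <= V w)%R ->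
  (forall A B : set R, measurable A -> measurable B ->
     P (U @^-1` A `&` V @^-1` B) = P (U @^-1` A) * P (V @^-1` B)) ->
  \int[P]_w (if (U w <= V w)%R then 1 else 0)%R%:E = \int[P]_w (Num.min 1 (V w))%:E.
Proof.
move=> [mU PU] mV V0 UV.
have mUV : measurable_fun setT (fun w => (U w, V w)) by exact: measurable_fun_pair.
pose f (p : R * R) : \bar R := (if (p.1 <= p.2)%R then 1 else 0)%R%:E.
have mf : measurable_fun setT f.
  apply/measurable_EFinP; apply: measurable_fun_ifT => //.
  exact: measurable_fun_ler.
have mle (v : R) : measurable [set u : R | (u <= v)%R].
  have -> : [set u : R | (u <= v)%R] = [set` `]-oo, v]] by apply/seteqP; split.
  exact: measurable_itv.
have f0 p : 0 <= f p by rewrite /f lee_fin; case: ifP.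
rewrite -(@ge0_integral_image_law _ _ _ _ _ P _ mUV f mf f0).
rewrite (eq_measure_integral (image_law P mU \x image_law P mV)); last first.
  move=> X mX _.
  apply: measure_eq_rectangles mX.
    by rewrite (le_lt_trans (probability_le1 _ _)) ?ltry.
  move=> A B mA mB.
  rewrite [RHS]product_measure1E// [X in _ = X * _]image_lawE.
  by rewrite [X in _ = _ * X]image_lawE -UV// image_lawE.
rewrite fubini_tonelli2// /fubini_G.
under eq_integral.
  move=> v _.
  rewrite (_ : \int[_]_x _ = (Num.max 0 (Num.min 1 v))%:E); first over.
  rewrite -uniform_prob_le -PU//.
  rewrite (eq_integral (fun x => (\1_[set u | (u <= v)%R] x)%:E)); last first.
    move=> u _; rewrite /f indicE/=; case: ifPn => h.
      by rewrite mem_set.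
    by rewrite memNset//; exact/negP.
  by rewrite integral_indic// setIT.
rewrite ge0_integral_image_law//.
- by apply: eq_integral => w _; rewrite max_r// le_min ler01 V0.
- by apply/measurable_EFinP; apply: measurable_maxr => //; exact: measurable_minr.
- by move=> v; rewrite lee_fin le_max lexx.
Qed.

End Independence.

(** * Acceptance probabilities *)

Section VectorAlgebra.
Context {R : realType} {d : nat}.
Implicit Types (u v : 'rV[R]_d) (A : 'M[R]_d) (z : d.-tuple R).

Lemma dotvE u v : dotv u v = \sum_i u 0 i * v 0 i.
Proof. by rewrite /dotv mxE; apply: eq_bigr => i _; rewrite mxE. Qed.

Lemma dotv_ge0 u : 0 <= dotv u u.
Proof. by rewrite dotvE sumr_ge0// => i _; rewrite -expr2 sqr_ge0. Qed.

Lemma dotv_eq0 u : (dotv u u == 0) = (u == 0).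
Proof.
apply/idP/eqP => [|->]; last by rewrite dotvE big1// => i _; rewrite mxE mul0r.
rewrite dotvE psumr_eq0; last by move=> i _; rewrite -expr2 sqr_ge0.
move=> /allP h; apply/rowP => i; rewrite mxE; apply/eqP.
by have := h i (mem_index_enum _); rewrite /= mulf_eq0 orbb.
Qed.

Lemma enorm_ge0 u : 0 <= enorm u. Proof. exact: sqrtr_ge0. Qed.

Lemma enorm_sqr u : enorm u ^+ 2 = dotv u u.
Proof. by rewrite sqr_sqrtr// dotv_ge0. Qed.

Lemma enorm_eq0 u : (enorm u == 0) = (u == 0).
Proof. by rewrite -dotv_eq0 -enorm_sqr sqrf_eq0. Qed.

Lemma bilE A u v : bil A u v = dotv (u *m A) v.
Proof. by []. Qed.

Lemma dotv_rowt u z : dotv u (rowt z) = tdot (fun i => u 0 i) z.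
Proof. by rewrite dotvE; apply: eq_bigr => i _; rewrite mxE. Qed.

Lemma rowt_inj : injective (@rowt R d).
Proof.
move=> z z' /rowP zz'; apply: eq_from_tnth => i.
by have := zz' i; rewrite !mxE.
Qed.

(** Identifies the conditioned quantity, a norm for Omega^2, with the squared length of Omega x. *)
Lemma sqn_mulmxx A u : A^T = A -> sqn (A *m A) u = dotv (u *m A) (u *m A).
Proof. by move=> At; rewrite /sqn /bil /dotv trmx_mul At !mulmxA. Qed.

Lemma measurable_rowt_coord (i : 'I_d) (A : 'M[R]_d) :
  measurable_fun setT (fun z : d.-tuple R => (rowt z *m A) 0 i).
Proof.
rewrite (_ : (fun _ => _) = tdot (fun j => A j i)); first exact: measurable_tdot.
by apply/funext => z; rewrite mxE; apply: eq_bigr => j _; rewrite mxE mulrC.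
Qed.

Lemma measurable_sqn A : measurable_fun setT (fun z : d.-tuple R => sqn A (rowt z)).
Proof.
rewrite (_ : (fun _ => _) = fun z => \sum_i (rowt z *m A) 0 i * tnth z i); last first.
  by apply/funext => z; rewrite /sqn bilE dotvE; apply: eq_bigr => i _; rewrite [X in _ * X]mxE.
apply: measurable_sum => i; apply: measurable_funM; first exact: measurable_rowt_coord.
exact: measurable_tnth.
Qed.

Lemma measurable_dotv d0 (T : measurableType d0) (Z Z' : T -> d.-tuple R) :
  measurable_fun setT Z -> measurable_fun setT Z' ->
  measurable_fun setT (fun w => dotv (rowt (Z w)) (rowt (Z' w))).
Proof.
move=> mZ mZ'.
rewrite (_ : (fun _ => _) = fun w => \sum_i tnth (Z w) i * tnth (Z' w) i); last first.
  by apply/funext => w; rewrite dotvE; apply: eq_bigr => i _; rewrite !mxE.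
apply: measurable_sum => i; apply: measurable_funM.
  exact: (measurableT_comp (measurable_tnth i) mZ).
exact: (measurableT_comp (measurable_tnth i) mZ').
Qed.

Lemma dotv_rowt_self z : dotv (rowt z) (rowt z) = sqn 1%:M (rowt z).
Proof. by rewrite /sqn bilE mulmx1. Qed.

(** Trades an inner product that depends on the coupling for two norms that depend on the marginals
    only. *)
Lemma ler_dotv_half u v : dotv u v <= (dotv u u + dotv v v) / 2.
Proof.
rewrite !dotvE -big_split/= mulr_suml; apply: ler_sum => i _.
have := sqr_ge0 (u 0 i - v 0 i); nra.
Qed.

Lemma nvecE (Om : 'M[R]_d) (x : 'rV[R]_d) i :
  nvec Om x 0 i = - ((enorm (x *m Om))^-1 * (x *m Om) 0 i).
Proof. by rewrite /nvec mxE [X in - X]mxE. Qed.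

Lemma sqr_nvec (Om : 'M[R]_d) (x : 'rV[R]_d) : x *m Om != 0 ->
  \sum_(i < d) nvec Om x 0 i ^+ 2 = 1.
Proof.
move=> xOm; have e0 : enorm (x *m Om) != 0 by rewrite enorm_eq0.
transitivity (dotv (nvec Om x) (nvec Om x)).
  by rewrite dotvE; apply: eq_bigr => i _; rewrite expr2.
rewrite dotvE; under eq_bigr do rewrite nvecE mulrNN mulrACA.
by rewrite -mulr_sumr -dotvE -enorm_sqr; field.
Qed.

Lemma nvec0 (Om : 'M[R]_d) (x : 'rV[R]_d) : x *m Om = 0 -> nvec Om x = 0.
Proof. by move=> xOm; rewrite /nvec xOm scaler0 oppr0. Qed.

(** For u = 0 both sides vanish and any unit vector serves; the first basis vector is taken. The
    linear term is thus always a multiple of a genuine standard normal. *)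
Lemma exists_unit_direction (u : 'rV[R]_d) : (0 < d)%N ->
  exists n : 'I_d -> R, \sum_(i < d) n i ^+ 2 = 1 /\
    forall z, - dotv u (rowt z) = enorm u * tdot n z.
Proof.
move=> d0; have [u0|u0] := eqVneq u 0.
  exists (fun i => (i == Ordinal d0)%:R); split.
    rewrite (bigD1 (Ordinal d0))// eqxx expr1n big1; first exact: addr0.
    by move=> i /negPf ->; rewrite expr0n.
  move=> z; have -> : enorm u = 0 by apply/eqP; rewrite enorm_eq0 u0.
  by rewrite mul0r u0 dotvE big1 ?oppr0// => i _; rewrite mxE mul0r.
have e0 : enorm u != 0 by rewrite enorm_eq0.
exists (fun i => - (u 0 i / enorm u)); split.
  under eq_bigr do rewrite sqrrN expr2 mulrACA.
  by rewrite -mulr_suml -dotvE -enorm_sqr; field.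
move=> z; rewrite dotv_rowt /tdot mulr_sumr -sumrN; apply: eq_bigr => i _; field.
exact: e0.
Qed.

End VectorAlgebra.

(** * Capped exponentials and their comonotone bound *)

Section TruncatedExponential.
Variable R : realType.
Implicit Types (s k u v a b : R).

(** The slope of min(1, e^a) never exceeds 1. The tangent bounds 1 + t <= e^t at t = b - a and t = b
    replace the mean value theorem. *)
Lemma min1_expR_lip a b :
  Num.min 1 (expR a) <= Num.min 1 (expR b) + `|a - b|.
Proof.
have e1 := expR_ge1Dx (b - a); have e2 := expR_ge1Dx b.
have eb := expR_ge0 b; have ea := expR_ge0 a.
have E : expR b = expR a * expR (b - a) by rewrite -expRD addrC subrK.
have [ab|ba] := leP a b.
  apply: (le_trans (y := Num.min 1 (expR b))); last by rewrite lerDl.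
  by rewrite le_min ge_min lexx/= ge_min ler_expR ab orbT.
rewrite ger0_norm; last by rewrite subr_ge0 ltW.
have [b0|b0] := leP 0 b.
  rewrite (min_l (y := expR b)); last by rewrite -expR0 ler_expR.
  by apply: (@le_trans _ _ 1%R); rewrite ?ge_min ?lexx// lerDl subr_ge0 ltW.
rewrite (min_r (x := 1) (y := expR b)); last by rewrite -expR0 ler_expR ltW.
have [a0|a0] := leP a 0.
  rewrite ge_min; apply/orP; right; rewrite E.
  have : expR a <= 1 by rewrite -expR0 ler_expR.
  nra.
by rewrite ge_min; apply/orP; left; nra.
Qed.

(** The probability that one uniform variable falls below both limiting acceptance ratios, given
    normal components u and v. *)
Definition cap_exp s1 s2 k u v : R :=
  Num.min 1 (expR (Num.min (s1 * u - k) (s2 * v - k))).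

Lemma cap_exp_ge0 s1 s2 k u v : 0 <= cap_exp s1 s2 k u v.
Proof. by rewrite le_min ler01 expR_ge0. Qed.

Lemma cap_exp_le1 s1 s2 k u v : cap_exp s1 s2 k u v <= 1.
Proof. by rewrite ge_min lexx. Qed.

(** Lets the random quadratic terms of the acceptance ratios be replaced by their common limit at an
    L1 cost. *)
Lemma cap_exp_lip s1 s2 k u v k1 k2 :
  `|Num.min 1 (expR (Num.min (s1 * u - k1) (s2 * v - k2))) - cap_exp s1 s2 k u v|
  <= `|k1 - k| + `|k2 - k|.
Proof.
have minlip (a b a' b' : R) : `|Num.min a b - Num.min a' b'| <= `|a - a'| + `|b - b'|.
  have ha := normr_ge0 (a - a'); have hb := normr_ge0 (b - b').
  have := ler_norm (a - a'); have := ler_norm (b - b').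
  have := ler_norm (a' - a); have := ler_norm (b' - b).
  rewrite (distrC a') (distrC b') ler_norml.
  by case: (leP a b) => ?; case: (leP a' b') => ? ? ? ? ?; lra.
have h := minlip (s1 * u - k1) (s2 * v - k2) (s1 * u - k) (s2 * v - k).
rewrite (_ : s1 * u - k1 - _ = k - k1) in h; last by ring.
rewrite (_ : s2 * v - k2 - _ = k - k2) in h; last by ring.
rewrite !(distrC k) in h; apply: le_trans h.
rewrite ler_norml; apply/andP; split.
  by rewrite lerNl opprB lerBlDl distrC; exact: min1_expR_lip.
by rewrite lerBlDl; exact: min1_expR_lip.
Qed.

(* The curves [t |-> e^(s t - k)] cross at [t = 0], so their minimum along the
   diagonal is the sum of a function of [u] and a function of [v], and off the
   diagonal that sum is an upper bound: comonotone arguments are optimal. *)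
Lemma cap_exp_split s1 s2 k : 0 <= s1 -> 0 <= s2 ->
  exists (F1 F2 : R -> R) (c : R),
  [/\ measurable_fun setT F1, measurable_fun setT F2,
      (forall t, 0 <= F1 t <= 1) /\ (forall t, 0 <= F2 t <= 1), 0 <= c <= 1 &
      (forall u v, cap_exp s1 s2 k u v + c <= F1 u + F2 v) /\
      (forall t, cap_exp s1 s2 k t t + c = F1 t + F2 t)].
Proof.
wlog s12 : s1 s2 / s1 <= s2.
  move=> wl s10 s20; have [s12|s21] := leP s1 s2; first exact: wl.
  have [F1 [F2 [c [m1 m2 [b1 b2] bc [le eq]]]]] := wl _ _ (ltW s21) s20 s10.
  exists F2, F1, c; split => //; split => [u v|t].
    by rewrite [leRHS]addrC /cap_exp (minC (s1 * u - k)); exact: le.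
  by rewrite [RHS]addrC -eq /cap_exp (minC (s1 * t - k)).
move=> s10 s20.
pose phi a := Num.min 1 (expR a) : R.
have phile a b : a <= b -> phi a <= phi b.
  by move=> ab; rewrite le_min ge_min lexx/= ge_min ler_expR ab orbT.
have phi01 a : 0 <= phi a <= 1.
  by rewrite le_min ler01 expR_ge0 ge_min lexx.
have mphi (f : R -> R) : measurable_fun setT f -> measurable_fun setT (fun t => phi (f t)).
  by move=> mf; apply: measurable_minr => //; exact: measurableT_comp.
(* Since s1 <= s2, the lower curve is the first for t >= 0 and the second for t <= 0. Each function
   follows its curve where it is the lower one and is frozen at the crossing value [phi (- k)]
   elsewhere; that value is therefore counted once too often, which [c] compensates. *)
exists (fun u => phi (s1 * Num.max u 0 - k)), (fun v => phi (s2 * Num.min v 0 - k)),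
  (phi (- k)); split.
- apply: mphi; apply: measurable_funB => //; apply: measurable_funM => //.
  exact: measurable_maxr.
- apply: mphi; apply: measurable_funB => //; apply: measurable_funM => //.
  exact: measurable_minr.
- by split.
- by [].
split=> [u v|t].
  (* For v <= 0 the second function bounds the minimum and the first is at least [c]; for v > 0 the
     second equals [c] and the first bounds the minimum. *)
  have [v0|v0] := leP v 0.
    rewrite addrC lerD//; apply: phile.
      by rewrite -[leLHS]add0r lerD2r mulr_ge0// le_max lexx orbT.
    by rewrite ge_min lexx orbT.
  rewrite (_ : s2 * 0 - k = - k); last by ring.
  rewrite lerD2r; apply: phile; rewrite ge_min lerD2r ler_wpM2l// le_max lexx//.
rewrite /cap_exp; have [t0|t0] := leP t 0.
  rewrite (_ : s1 * 0 - k = - k); last by ring.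
  rewrite [RHS]addrC (min_r (x := s1 * t - k))// lerD2r; nra.
rewrite (_ : s2 * 0 - k = - k); last by ring.
rewrite (min_l (x := s1 * t - k))// lerD2r; nra.
Qed.

End TruncatedExponential.

(** * Gaussian projections and the limiting acceptance probability *)

Section Acceptance.
Context {R : realType}.
Local Notation gamma := (stdnormal R).
Local Notation gauss := (gauss R).
Local Open Scope ereal_scope.

(** After the component along n is resampled, it is the fresh normal variable itself. *)
Lemma ge0_integral_gauss_tdot d (n : 'I_d -> R) (F : R -> \bar R) :
  (\sum_(i < d) n i ^+ 2 = 1)%R ->
  measurable_fun setT F -> (forall t, 0 <= F t) ->
  \int[gauss d]_z F (tdot n z) = \int[gamma]_t F t.
Proof.
move=> n1 mF F0.
rewrite -(gauss_replace_direction n1 (f := fun z => F (tdot n z))) //; last first.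
  exact: (measurableT_comp mF (@measurable_tdot _ _ n)).
rewrite (eq_integral (fun=> \int[gamma]_t F t)); last first.
  move=> z _; apply: eq_integral => t _; rewrite tdot_tshift//.
  by congr F; rewrite addrC subrK.
exact: integral_probability_cst.
Qed.

Lemma ge0_integral_std_gauss d d0 (T : measurableType d0) (P : probability T R)
    (Z : T -> d.-tuple R) (F : d.-tuple R -> \bar R) : std_gauss_law P Z ->
  measurable_fun setT F -> (forall z, 0 <= F z) ->
  \int[P]_w F (Z w) = \int[gauss d]_z F z.
Proof.
move=> PZ; apply: eq_integral_law; first exact: PZ.1.
exact: std_gauss_law_gauss.
Qed.

Lemma ge0_integral_std_gauss_tdot d d0 (T : measurableType d0) (P : probability T R)
    (Z : T -> d.-tuple R) (n : 'I_d -> R) (F : R -> \bar R) :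
  std_gauss_law P Z -> (\sum_(i < d) n i ^+ 2 = 1)%R ->
  measurable_fun setT F -> (forall t, 0 <= F t) ->
  \int[P]_w F (tdot n (Z w)) = \int[gamma]_t F t.
Proof.
move=> PZ n1 mF F0; rewrite -(ge0_integral_gauss_tdot n1 mF F0).
apply: (ge0_integral_std_gauss (F := fun z => F (tdot n z)) PZ) => //.
exact: (measurableT_comp mF (measurable_tdot n)).
Qed.

Definition logacc d (Om : 'M[R]_d) (h : R) (x : 'rV[R]_d) (z : d.-tuple R) : R :=
  (- (h * bil Om x (rowt z)) - h ^+ 2 * sqn Om (rowt z) / 2)%R.

Lemma measurable_logacc d (Om : 'M[R]_d) h (x : 'rV[R]_d) :
  measurable_fun setT (logacc Om h x).
Proof.
apply: measurable_funB.
  rewrite (_ : (fun _ => _) = fun z => (- (h * tdot (fun i => (x *m Om)%R 0 i) z))%R).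
    by apply: measurableT_comp => //; apply: measurable_funM => //; exact: measurable_tdot.
  by apply/funext => z; rewrite bilE dotv_rowt.
by do 2 apply: measurable_funM => //; exact: measurable_sqn.
Qed.

Lemma acceptE d (Om : 'M[R]_d) h (x : 'rV[R]_d) u z :
  accept Om h x u z = (if u <= expR (logacc Om h x z) then 1 else 0)%R.
Proof. by []. Qed.

(** This error and the next are integrals against one Gaussian, hence take the same value for either
    chain and for every coupling with the right marginals. *)
Definition err_norm d (h m : R) : \bar R :=
  \int[gauss d]_z `|h ^+ 2 * dotv (rowt z) (rowt z) - m|%:E.
Definition err_quad d (Om : 'M[R]_d) (h k : R) : \bar R :=
  \int[gauss d]_z `|h ^+ 2 * sqn Om (rowt z) / 2 - k|%:E.

Definition cap_mean (s1 s2 k : R) : \bar R := \int[gamma]_t (cap_exp s1 s2 k t t)%:E.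

Lemma measurable_cap_exp s1 s2 k d0 (T : measurableType d0) (f g : T -> R) :
  measurable_fun setT f -> measurable_fun setT g ->
  measurable_fun setT (fun w => cap_exp s1 s2 k (f w) (g w)).
Proof.
move=> mf mg; apply: measurable_minr => //; apply: measurableT_comp => //.
by apply: measurable_minr; apply: measurable_funB => //; exact: measurable_funM.
Qed.

Lemma cap_mean_ge0 s1 s2 k : 0 <= cap_mean s1 s2 k.
Proof. by apply: integral_ge0 => t _; rewrite lee_fin cap_exp_ge0. Qed.

Lemma cap_mean_le1 s1 s2 k : cap_mean s1 s2 k <= 1.
Proof.
rewrite -[leRHS](integral_probability_cst gamma); apply: ge0_le_integral => //.
- by move=> t _; rewrite lee_fin cap_exp_ge0.
- by apply/measurable_EFinP; exact: measurable_cap_exp.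
- by move=> t _; rewrite lee_fin cap_exp_le1.
Qed.

(** Once [c] is added to both sides, [cap_exp_split] bounds the left integrand by a sum of functions
    of one marginal each. Both marginals are standard normal, so the integrals can be evaluated at a
    common variable, where the split is an equality. *)
Lemma comonotone_cap_le d0 (T : measurableType d0) (P : probability T R)
    d (Zx Zy : T -> d.-tuple R) (n1 n2 : 'I_d -> R) (s1 s2 k : R) :
  std_gauss_law P Zx -> std_gauss_law P Zy ->
  (\sum_(i < d) n1 i ^+ 2 = 1)%R -> (\sum_(i < d) n2 i ^+ 2 = 1)%R ->
  (0 <= s1)%R -> (0 <= s2)%R ->
  \int[P]_w (cap_exp s1 s2 k (tdot n1 (Zx w)) (tdot n2 (Zy w)))%:E <= cap_mean s1 s2 k.
Proof.
move=> gx gy u1 u2 s10 s20.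
have [F1 [F2 [c [mF1 mF2 [b1 b2] /andP[c0 _] [Fle Feq]]]]] := cap_exp_split k s10 s20.
have mx1 : measurable_fun setT (fun w => tdot n1 (Zx w)).
  exact: (measurableT_comp (measurable_tdot n1) gx.1).
have my2 : measurable_fun setT (fun w => tdot n2 (Zy w)).
  exact: (measurableT_comp (measurable_tdot n2) gy.1).
have F10 t : 0 <= (F1 t)%:E by rewrite lee_fin; case/andP: (b1 t).
have F20 t : 0 <= (F2 t)%:E by rewrite lee_fin; case/andP: (b2 t).
have eF1 : measurable_fun setT (fun t => (F1 t)%:E) by exact/measurable_EFinP.
have eF2 : measurable_fun setT (fun t => (F2 t)%:E) by exact/measurable_EFinP.
rewrite -(leeD2rE _ _ (x := c%:E))//.
rewrite -[X in _ + X <= _](integral_probability_cst P).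
rewrite -[X in _ <= _ + X](integral_probability_cst gamma).
rewrite -ge0_integralD//; last 2 first.
- by move=> w _; rewrite lee_fin cap_exp_ge0.
- by apply/measurable_EFinP; exact: measurable_cap_exp.
rewrite -ge0_integralD//; last 2 first.
- by move=> w _; rewrite lee_fin cap_exp_ge0.
- by apply/measurable_EFinP; exact: measurable_cap_exp.
rewrite [leRHS](eq_integral (fun t => (F1 t)%:E + (F2 t)%:E)); last first.
  by move=> t _; rewrite -!EFinD Feq.
rewrite [leRHS]ge0_integralD//.
have e1 := ge0_integral_std_gauss_tdot gx u1 eF1 F10.
have e2 := ge0_integral_std_gauss_tdot gy u2 eF2 F20.
apply: (@le_trans _ _ (\int[P]_w (F1 (tdot n1 (Zx w)))%:E +
                       \int[P]_w (F2 (tdot n2 (Zy w)))%:E)); last first.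
  by rewrite e1 e2.
have mP1 : measurable_fun setT (fun w => (F1 (tdot n1 (Zx w)))%:E).
  exact: (measurableT_comp eF1 mx1).
have mP2 : measurable_fun setT (fun w => (F2 (tdot n2 (Zy w)))%:E).
  exact: (measurableT_comp eF2 my2).
rewrite -ge0_integralD//; apply: ge0_le_integral => //.
- by move=> w _; rewrite -EFinD lee_fin addr_ge0// cap_exp_ge0.
- by apply: emeasurable_funD => //; apply/measurable_EFinP; exact: measurable_cap_exp.
- exact: emeasurable_funD.
- by move=> w _; rewrite -!EFinD lee_fin.
Qed.

End Acceptance.

Arguments cp_Ux {R d} c _.
Arguments cp_Uy {R d} c _.
Arguments cp_Zx {R d} c _.
Arguments cp_Zy {R d} c _.

(** * One-sided comparison of integrals of signed functions *)

Section IntegralBounds.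
Context {R : realType} {d0 : measure_display} {T : measurableType d0}.
Variable P : probability T R.
Local Open Scope ereal_scope.

(** Integrability of f is not assumed: its integral is at most that of its positive part, which g
    dominates. *)
Lemma integral_le_ge0 (f g : T -> R) :
  measurable_fun setT f -> measurable_fun setT g ->
  (forall w, 0 <= g w)%R -> (forall w, f w <= g w)%R ->
  \int[P]_w (f w)%:E <= \int[P]_w (g w)%:E.
Proof.
move=> mf mg g0 fg; rewrite integralE.
have ef : measurable_fun setT (EFin \o f) by exact/measurable_EFinP.
apply: (@le_trans _ _ (\int[P]_w ((EFin \o f)^\+ w))).
  rewrite -[leRHS]sube0; apply: leeB => //.
  by apply: integral_ge0 => w _; exact: funeneg_ge0.
apply: ge0_le_integral => //.
- exact: measurable_funepos.
- exact/measurable_EFinP.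
- by move=> w _; rewrite funeposE/= ge_max !lee_fin fg g0.
Qed.

(** From f >= g - e >= - e the negative part of f is dominated by e. Its integral is therefore
    finite and may be moved across the inequality, leaving nonnegative integrands. *)
Lemma integral_ge_perturb (f g e : T -> R) :
  measurable_fun setT f -> measurable_fun setT g -> measurable_fun setT e ->
  (forall w, 0 <= g w)%R -> (forall w, 0 <= e w)%R ->
  (forall w, g w <= f w + e w)%R ->
  \int[P]_w (e w)%:E < +oo ->
  \int[P]_w (g w)%:E <= \int[P]_w (f w)%:E + \int[P]_w (e w)%:E.
Proof.
move=> mf mg me g0 e0 gfe eoo; rewrite [X in _ <= X + _]integralE.
have ef : measurable_fun setT (EFin \o f) by exact/measurable_EFinP.
have eg : measurable_fun setT (EFin \o g) by exact/measurable_EFinP.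
have ee : measurable_fun setT (EFin \o e) by exact/measurable_EFinP.
have mp := measurable_funepos ef; have mn := measurable_funeneg ef.
have n0 : 0 <= \int[P]_w ((EFin \o f)^\- w).
  by apply: integral_ge0 => w _; exact: funeneg_ge0.
have nfin : \int[P]_w ((EFin \o f)^\- w) \is a fin_num.
  rewrite ge0_fin_numE//; apply: le_lt_trans eoo; apply: ge0_le_integral => //.
  move=> w _; rewrite funenegE/= ge_max !lee_fin e0 andbT lerNl.
  by have := gfe w; have := g0 w; lra.
rewrite addeAC leeBrDr//; rewrite -ge0_integralD//; last first.
  by move=> w _; rewrite lee_fin.
rewrite -ge0_integralD//; last by move=> w _; rewrite lee_fin.
apply: ge0_le_integral => //.
- by move=> w _; rewrite adde_ge0// lee_fin.
- exact: emeasurable_funD.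
- exact: emeasurable_funD.
move=> w _; rewrite funenegE funeposE/= -!EFin_max -!EFinD lee_fin.
have := gfe w; have := g0 w; have := e0 w.
by case: (leP (f w) 0%R) => ?; case: (leP (- f w)%R 0%R) => ? ? ? ?; lra.
Qed.

Lemma integral_cap_perturb (s1 s2 k : R) (u v k1 k2 : T -> R) :
  measurable_fun setT u -> measurable_fun setT v ->
  measurable_fun setT k1 -> measurable_fun setT k2 ->
  let A w := (Num.min 1 (expR (Num.min (s1 * u w - k1 w) (s2 * v w - k2 w))))%R in
  let C w := cap_exp s1 s2 k (u w) (v w) in
  let E := \int[P]_w `|k1 w - k|%:E + \int[P]_w `|k2 w - k|%:E in
  \int[P]_w (A w)%:E <= \int[P]_w (C w)%:E + E /\
  \int[P]_w (C w)%:E <= \int[P]_w (A w)%:E + E.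
Proof.
move=> mu mv mk1 mk2 A C E.
have mA : measurable_fun setT (fun w => (A w)%:E).
  apply/measurable_EFinP; apply: measurable_minr => //; apply: measurableT_comp => //.
  by apply: measurable_minr; apply: measurable_funB => //; exact: measurable_funM.
have mC : measurable_fun setT (fun w => (C w)%:E).
  by apply/measurable_EFinP; exact: measurable_cap_exp.
have A0 w : 0 <= (A w)%:E by rewrite lee_fin le_min ler01 expR_ge0.
have C0 w : 0 <= (C w)%:E by rewrite lee_fin cap_exp_ge0.
have mk (q : T -> R) : measurable_fun setT q -> measurable_fun setT (fun w => `|q w - k|%:E).
  by move=> mq; apply/measurable_EFinP; apply: measurableT_comp => //; exact: measurable_funB.
have q0 (q : T -> R) w : 0 <= `|q w - k|%:E by rewrite lee_fin.
have EE : E = \int[P]_w (`|k1 w - k|%:E + `|k2 w - k|%:E).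
  by rewrite ge0_integralD//; exact: mk.
have mE : measurable_fun setT (fun w => `|k1 w - k|%:E + `|k2 w - k|%:E).
  by apply: emeasurable_funD; exact: mk.
have lip w := cap_exp_lip s1 s2 k (u w) (v w) (k1 w) (k2 w).
have E0 w : 0 <= `|k1 w - k|%:E + `|k2 w - k|%:E by rewrite adde_ge0.
by rewrite EE; split; rewrite -ge0_integralD//; (apply: ge0_le_integral => //;
  [exact: emeasurable_funD|]) => w _; rewrite -!EFinD lee_fin;
  have := lip w; rewrite -/(A w) -/(C w) ler_norml => /andP[]; lra.
Qed.

End IntegralBounds.

(** * Upper bound over the class I *)

Section UpperBound.
Context {R : realType} {d : nat}.
Local Notation gauss := (gauss R).
Local Open Scope ereal_scope.

Lemma logacc_direction (Om : 'M[R]_d) (h : R) (x : 'rV[R]_d) : (0 < d)%N ->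
  exists n : 'I_d -> R, (\sum_(i < d) n i ^+ 2 = 1)%R /\
    forall z, logacc Om h x z =
      (h * enorm (x *m Om) * tdot n z - h ^+ 2 * sqn Om (rowt z) / 2)%R.
Proof.
move=> d_gt0; have [n [n1 nE]] := exists_unit_direction (x *m Om)%R d_gt0.
exists n; split => // z; rewrite /logacc bilE.
by rewrite -(mulrA h) -nE mulrN.
Qed.

Lemma measurable_quad (Om : 'M[R]_d) (h : R) d0 (T : measurableType d0)
    (Z : T -> d.-tuple R) : measurable_fun setT Z ->
  measurable_fun setT (fun w => h ^+ 2 * sqn Om (rowt (Z w)) / 2)%R.
Proof.
move=> mZ; do 2 apply: measurable_funM => //.
exact: (measurableT_comp (measurable_sqn Om) mZ).
Qed.

Lemma integral_err_quad (Om : 'M[R]_d) (h k : R) d0 (T : measurableType d0)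
    (P : probability T R) (Z : T -> d.-tuple R) : std_gauss_law P Z ->
  \int[P]_w `|h ^+ 2 * sqn Om (rowt (Z w)) / 2 - k|%:E = err_quad Om h k.
Proof.
move=> PZ.
apply: (ge0_integral_std_gauss (F := fun z => `|h ^+ 2 * sqn Om (rowt z) / 2 - k|%:E) PZ) => //.
apply/measurable_EFinP; apply: measurableT_comp => //; apply: measurable_funB => //.
exact: measurable_quad.
Qed.

Lemma integral_err_norm (h m : R) d0 (T : measurableType d0)
    (P : probability T R) (Z : T -> d.-tuple R) : std_gauss_law P Z ->
  \int[P]_w `|h ^+ 2 * dotv (rowt (Z w)) (rowt (Z w)) - m|%:E = err_norm d h m.
Proof.
move=> PZ.
apply: (ge0_integral_std_gauss
  (F := fun z => `|h ^+ 2 * dotv (rowt z) (rowt z) - m|%:E) PZ) => //.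
apply/measurable_EFinP; apply: measurableT_comp => //; apply: measurable_funB => //.
by apply: measurable_funM => //; exact: (@measurable_dotv _ _ _ _ id id).
Qed.

Variables (Om : 'M[R]_d) (h : R) (x y : 'rV[R]_d) (c : coupling R d).
Hypotheses (d_gt0 : (0 < d)%N) (h_ge0 : (0 <= h)%R) (cI : in_I c).
Let P := cp_P c.

(** Membership in the class makes [Ux] independent of [Zx] and [Zy] jointly. This is needed because
    the threshold compared with [Ux] in [in_I_accept_le] depends on both proposals. *)
Lemma in_I_indep_l (phi : d.-tuple R * d.-tuple R -> R) (A B : set R) :
  measurable_fun setT phi -> measurable A -> measurable B ->
  P (cp_Ux c @^-1` A `&` (fun w => phi (cp_Zx c w, cp_Zy c w)) @^-1` B) =
  P (cp_Ux c @^-1` A) * P ((fun w => phi (cp_Zx c w, cp_Zy c w)) @^-1` B).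
Proof.
move=> mphi mA mB; have [_ [_ [_ [_ [_ [_ ind]]]]]] := cI.
have := ind (A `*` setT) (phi @^-1` B) (measurableX mA measurableT).
rewrite -[X in measurable X]setTI => /(_ (mphi measurableT _ mB)).
rewrite (_ : _ @^-1` (A `*` setT) = cp_Ux c @^-1` A)//.
by apply/seteqP; split => w //= [].
Qed.

Lemma in_I_indep_r (phi : d.-tuple R * d.-tuple R -> R) (A B : set R) :
  measurable_fun setT phi -> measurable A -> measurable B ->
  P (cp_Uy c @^-1` A `&` (fun w => phi (cp_Zx c w, cp_Zy c w)) @^-1` B) =
  P (cp_Uy c @^-1` A) * P ((fun w => phi (cp_Zx c w, cp_Zy c w)) @^-1` B).
Proof.
move=> mphi mA mB; have [_ [_ [_ [_ [_ [_ ind]]]]]] := cI.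
have := ind (setT `*` A) (phi @^-1` B) (measurableX measurableT mA).
rewrite -[X in measurable X]setTI => /(_ (mphi measurableT _ mB)).
rewrite (_ : _ @^-1` (setT `*` A) = cp_Uy c @^-1` A)//.
by apply/seteqP; split => w //= [].
Qed.

Let lx w := logacc Om h x (cp_Zx c w).
Let ly w := logacc Om h y (cp_Zy c w).

Lemma in_I_measurable_logacc :
  measurable_fun setT lx /\ measurable_fun setT ly.
Proof.
have [_ [_ [[mZx _] [[mZy _] _]]]] := cI.
by split; [exact: (measurableT_comp (measurable_logacc Om h x) mZx)|
           exact: (measurableT_comp (measurable_logacc Om h y) mZy)].
Qed.

Lemma in_I_measurable_accept :
  measurable_fun setT (fun w => accept Om h x (cp_Ux c w) (cp_Zx c w)) /\
  measurable_fun setT (fun w => accept Om h y (cp_Uy c w) (cp_Zy c w)).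
Proof.
have [mlx mly] := in_I_measurable_logacc; have [[mUx _] [[mUy _] _]] := cI.
by split; apply: measurable_fun_ifT => //; apply: measurable_fun_ler => //;
  exact: measurableT_comp.
Qed.

(* Splitting according to which of the two acceptance ratios is the smaller
   reduces the joint law of the uniforms to their marginals. *)
Lemma in_I_accept_le :
  \int[P]_w (accept Om h x (cp_Ux c w) (cp_Zx c w) *
             accept Om h y (cp_Uy c w) (cp_Zy c w))%:E <=
  \int[P]_w (Num.min 1 (expR (Num.min (lx w) (ly w))))%:E.
Proof.
have [max may] := in_I_measurable_accept.
have [uUx [uUy _]] := cI; have [mUx _] := uUx; have [mUy _] := uUy.
pose fx (p : d.-tuple R * d.-tuple R) := logacc Om h x p.1.
pose fy (p : d.-tuple R * d.-tuple R) := logacc Om h y p.2.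
have mfx : measurable_fun setT fx.
  by apply: (measurableT_comp (measurable_logacc Om h x)).
have mfy : measurable_fun setT fy.
  by apply: (measurableT_comp (measurable_logacc Om h y)).
(* Each threshold is the acceptance ratio where it is the smaller of the two and 0 elsewhere. If
   both proposals are accepted, the smaller ratio is passed and one of [bx], [by_] is 1; a threshold
   0 contributes nothing on average, so the two expectations add up to that of the capped
   minimum. *)
pose vx p := (if fx p <= fy p then expR (fx p) else 0)%R.
pose vy p := (if fx p <= fy p then 0 else expR (fy p))%R.
have mvx : measurable_fun setT vx.
  apply: measurable_fun_ifT => //; first exact: measurable_fun_ler.
  exact: measurableT_comp.
have mvy : measurable_fun setT vy.
  apply: measurable_fun_ifT => //; first exact: measurable_fun_ler.
  exact: measurableT_comp.
pose W w := (cp_Zx c w, cp_Zy c w).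
have [_ [_ [[mZx _] [[mZy _] _]]]] := cI.
have mW : measurable_fun setT W by exact: measurable_fun_pair.
have mvxW : measurable_fun setT (fun w => vx (W w)) by exact: (measurableT_comp mvx mW).
have mvyW : measurable_fun setT (fun w => vy (W w)) by exact: (measurableT_comp mvy mW).
pose bx w : R := if (cp_Ux c w <= vx (W w))%R then 1%R else 0%R.
pose by_ w : R := if (cp_Uy c w <= vy (W w))%R then 1%R else 0%R.
have mbx : measurable_fun setT bx.
  by apply: measurable_fun_ifT => //; exact: measurable_fun_ler.
have mby : measurable_fun setT by_.
  by apply: measurable_fun_ifT => //; exact: measurable_fun_ler.
have b0 w : (0 <= bx w)%R /\ (0 <= by_ w)%R by rewrite /bx /by_; do 2 case: ifP.
apply: (@le_trans _ _ (\int[P]_w (bx w + by_ w)%:E)).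
  apply: integral_le_ge0 => //; [exact: measurable_funM|exact: measurable_funD| |].
    by move=> w; have [? ?] := b0 w; rewrite addr_ge0.
  move=> w; have [h1 h2] := b0 w.
  rewrite !acceptE -/(lx w) -/(ly w).
  case: ifPn => [ux|_]; last by rewrite mul0r addr_ge0.
  case: ifPn => [uy|_]; last by rewrite mulr0 addr_ge0.
  rewrite mulr1; move: h1 h2; rewrite /bx /by_ /vx /vy /fx /fy /= -/(lx w) -/(ly w).
  by case: (leP (lx w) (ly w)) => _ *; rewrite ?ux ?uy ?lerDl ?lerDr.
under eq_integral do rewrite EFinD.
rewrite ge0_integralD//; last 4 first.
- by move=> w _; rewrite lee_fin; case: (b0 w).
- exact/measurable_EFinP.
- by move=> w _; rewrite lee_fin; case: (b0 w).
- exact/measurable_EFinP.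
have vx0 w : (0 <= vx (W w))%R by rewrite /vx; case: ifP; rewrite ?expR_ge0.
have vy0 w : (0 <= vy (W w))%R by rewrite /vy; case: ifP; rewrite ?expR_ge0.
rewrite (uniform_le_indep uUx mvxW vx0); last first.
  by move=> A B mA mB; exact: in_I_indep_l.
rewrite (uniform_le_indep uUy mvyW vy0); last first.
  by move=> A B mA mB; exact: in_I_indep_r.
rewrite -ge0_integralD//; last 4 first.
- by move=> w _; rewrite lee_fin le_min ler01 vx0.
- by apply/measurable_EFinP; exact: measurable_minr.
- by move=> w _; rewrite lee_fin le_min ler01 vy0.
- by apply/measurable_EFinP; exact: measurable_minr.
rewrite le_eqVlt; apply/orP; left; apply/eqP; apply: eq_integral => w _.
rewrite -EFinD; congr EFin; rewrite /vx /vy /fx /fy /= -/(lx w) -/(ly w).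
by case: (leP (lx w) (ly w)) => _; rewrite (min_r ler01) ?addr0 ?add0r.
Qed.

Lemma in_I_expect_le (k : R) :
  \int[P]_w (Num.min 1 (expR (Num.min (lx w) (ly w))))%:E <=
  cap_mean (h * enorm (x *m Om)) (h * enorm (y *m Om)) k +
  (err_quad Om h k + err_quad Om h k).
Proof.
have [n1 [u1 n1E]] := logacc_direction Om h x d_gt0.
have [n2 [u2 n2E]] := logacc_direction Om h y d_gt0.
have [_ [_ [gx [gy _]]]] := cI.
under eq_integral do rewrite /lx /ly n1E n2E.
have mx : measurable_fun setT (fun w => tdot n1 (cp_Zx c w)).
  exact: (measurableT_comp (measurable_tdot n1) gx.1).
have my : measurable_fun setT (fun w => tdot n2 (cp_Zy c w)).
  exact: (measurableT_comp (measurable_tdot n2) gy.1).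
have [+ _] := integral_cap_perturb P (h * enorm (x *m Om))%R (h * enorm (y *m Om))%R k
  mx my (measurable_quad Om h gx.1) (measurable_quad Om h gy.1).
rewrite (integral_err_quad Om h k gx) (integral_err_quad Om h k gy) => /le_trans; apply.
by apply: leeD => //; apply: comonotone_cap_le => //; rewrite mulr_ge0// enorm_ge0.
Qed.

(** Pointwise, h^2 Zx.Zy exceeds m by at most the two norm errors; the indicators only take the
    values 0 and 1, so m times the acceptance probability remains. *)
Lemma in_I_cross_expect_le (m k : R) : (0 <= m)%R ->
  cross_expect Om h x y c <=
  m%:E * cap_mean (h * enorm (x *m Om)) (h * enorm (y *m Om)) k +
  (err_norm d h m + err_norm d h m + m%:E * (err_quad Om h k + err_quad Om h k)).
Proof.
move=> m0; have [max may] := in_I_measurable_accept.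
have [_ [_ [gx [gy _]]]] := cI; have [mZx _] := gx; have [mZy _] := gy.
pose ax w := accept Om h x (cp_Ux c w) (cp_Zx c w).
pose ay w := accept Om h y (cp_Uy c w) (cp_Zy c w).
pose e (Z : cp_T c -> d.-tuple R) w := `|h ^+ 2 * dotv (rowt (Z w)) (rowt (Z w)) - m|%R.
have me Z : measurable_fun setT Z -> measurable_fun setT (e Z).
  move=> mZ; apply: measurableT_comp => //; apply: measurable_funB => //.
  apply: measurable_funM => //.
  exact: measurable_dotv.
have mex := me _ mZx; have mey := me _ mZy.
have e0 Z w : (0 <= e Z w)%R by exact: normr_ge0.
have ax01 w : ax w = 0%R \/ ax w = 1%R by rewrite /ax /accept; case: ifP; [right|left].
have ay01 w : ay w = 0%R \/ ay w = 1%R by rewrite /ay /accept; case: ifP; [right|left].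
have a0 w : (0 <= ax w * ay w)%R.
  by case: (ax01 w) => ->; case: (ay01 w) => ->; rewrite ?mul0r ?mulr0 ?mulr1.
apply: (@le_trans _ _ (\int[P]_w (m * (ax w * ay w) + (e (cp_Zx c) w + e (cp_Zy c) w))%:E)).
  apply: integral_le_ge0.
  - apply: measurable_funM => //; apply: measurable_funM => //.
    apply: measurable_funM => //.
    exact: measurable_dotv.
  - apply: measurable_funD; last exact: measurable_funD.
    by apply: measurable_funM => //; exact: measurable_funM.
  - by move=> w; rewrite !addr_ge0// mulr_ge0.
  - move=> w; rewrite -/(ax w) -/(ay w) -(mulrA _ (ax w)).
    have h1 := ler_dotv_half (rowt (cp_Zx c w)) (rowt (cp_Zy c w)).
    have h2 : (h ^+ 2 * dotv (rowt (cp_Zx c w)) (rowt (cp_Zy c w)) <=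
      h ^+ 2 * ((dotv (rowt (cp_Zx c w)) (rowt (cp_Zx c w)) +
                 dotv (rowt (cp_Zy c w)) (rowt (cp_Zy c w))) / 2))%R.
      by rewrite ler_wpM2l// sqr_ge0.
    have n1 := ler_norm (h ^+ 2 * dotv (rowt (cp_Zx c w)) (rowt (cp_Zx c w)) - m)%R.
    have n2 := ler_norm (h ^+ 2 * dotv (rowt (cp_Zy c w)) (rowt (cp_Zy c w)) - m)%R.
    have := e0 (cp_Zx c) w; have := e0 (cp_Zy c) w; rewrite /e.
    move: n1 n2; set ex := `|_|%R; set ey := `|_|%R => n1 n2 ey0 ex0.
    by case: (ax01 w) => ->; case: (ay01 w) => ->; rewrite ?mul0r ?mulr0 ?mulr1 ?add0r; lra.
have mm : measurable_fun setT (fun w => (ax w * ay w)%:E).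
  by apply/measurable_EFinP; exact: measurable_funM.
under eq_integral do rewrite EFinD [X in _ + X]EFinD EFinM.
rewrite ge0_integralD//; last 4 first.
- by move=> w _; rewrite mule_ge0 ?lee_fin.
- exact: measurable_funeM.
- by move=> w _; rewrite adde_ge0 ?lee_fin.
- by apply: emeasurable_funD; exact/measurable_EFinP.
rewrite ge0_integralZl_EFin//; last by move=> w _; rewrite lee_fin.
rewrite [X in _ + X <= _]ge0_integralD//; last 4 first.
- by move=> w _; rewrite lee_fin.
- exact/measurable_EFinP.
- by move=> w _; rewrite lee_fin.
- exact/measurable_EFinP.
rewrite (integral_err_norm h m gx) (integral_err_norm h m gy).
rewrite addeC [leRHS]addeCA; apply: leeD => //.
have q0 : 0 <= err_quad Om h k by apply: integral_ge0 => z _; rewrite lee_fin.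
rewrite -ge0_muleDr; [|exact: cap_mean_ge0|exact: adde_ge0].
apply: lee_wpmul2l; first by rewrite lee_fin.
exact: le_trans in_I_accept_le (in_I_expect_le k).
Qed.

End UpperBound.

(** * The GCRN coupling *)

Section TripleIndependence.
Context {R : realType} {d0 d1 d2 : measure_display} {T : measurableType d0}
  {T1 : measurableType d1} {T2 : measurableType d2}.
Variables (P : probability T R) (U : T -> R) (Z : T -> T1) (Y : T -> T2).
Variables (Q1 : probability T1 R) (Q2 : probability T2 R).
Local Open Scope ereal_scope.
Hypotheses (mU : measurable_fun setT U) (mZ : measurable_fun setT Z)
  (mY : measurable_fun setT Y).
Hypothesis PZ : forall A, measurable A -> P (Z @^-1` A) = Q1 A.
Hypothesis PY : forall A, measurable A -> P (Y @^-1` A) = Q2 A.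
Hypothesis UZY : forall (A : set R) (B : set T1) (C : set T2),
  measurable A -> measurable B -> measurable C ->
  P (U @^-1` A `&` Z @^-1` B `&` Y @^-1` C) =
  P (U @^-1` A) * P (Z @^-1` B) * P (Y @^-1` C).

Let ZY w := (Z w, Y w).
Let mZY : measurable_fun setT ZY. Proof. exact: measurable_fun_pair. Qed.

Lemma pair_law_prod X : measurable X -> P (ZY @^-1` X) = (Q1 \x Q2) X.
Proof.
move=> mX; rewrite -(image_lawE P mZY).
apply: measure_eq_rectangles mX.
  by rewrite (le_lt_trans (probability_le1 _ _)) ?ltry.
move=> A B mA mB; rewrite [LHS]image_lawE [RHS]product_measure1E//.
have := UZY measurableT mA mB; rewrite preimage_setT setTI probability_setT mul1e.
by rewrite PZ// PY// => <-.
Qed.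

(** At fixed A both sides are finite measures in X: the image of P restricted to the event U in A,
    and a multiple of the law of the pair. The triple product rule makes them agree on
    rectangles. *)
Lemma indep_pair A X : measurable A -> measurable X ->
  P (U @^-1` A `&` ZY @^-1` X) = P (U @^-1` A) * P (ZY @^-1` X).
Proof.
move=> mA mX.
have mUA : measurable (U @^-1` A) by rewrite -[X in measurable X]setTI; exact: mU.
have pfin : P (U @^-1` A) \is a fin_num by exact: fin_num_measure.
have p0 : (0 <= fine (P (U @^-1` A)))%R by exact: fine_ge0.
pose m1 := pushforward (mrestr P mUA) ZY.
pose m2 := mscale (NngNum p0) (image_law P mZY).
have -> : P (U @^-1` A `&` ZY @^-1` X) = m1 X by rewrite setIC.
have -> : P (U @^-1` A) * P (ZY @^-1` X) = m2 X.
  by rewrite /m2 /mscale/= fineK.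
apply: measure_eq_rectangles mX.
- change (P (ZY @^-1` setT `&` U @^-1` A) < +oo); rewrite preimage_setT setTI.
  by rewrite (le_lt_trans (probability_le1 _ _)) ?ltry.
- move=> B C mB mC.
  change (P ((Z @^-1` B `&` Y @^-1` C) `&` U @^-1` A) =
    (fine (P (U @^-1` A)))%:E * P (Z @^-1` B `&` Y @^-1` C)).
  rewrite fineK// setIC setIA UZY//.
  have := UZY measurableT mB mC; rewrite preimage_setT setTI probability_setT mul1e => ->.
  by rewrite muleA.
Qed.

End TripleIndependence.

Section GCRN.
Context {R : realType} {d : nat}.
Local Notation gamma := (stdnormal R).
Local Notation gauss := (gauss R).
Local Open Scope ereal_scope.

Definition nvec_coord (Om : 'M[R]_d) (x : 'rV[R]_d) : 'I_d -> R :=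
  (fun i => nvec Om x 0 i)%R.

(** The GCRN update z - (n.z) n + t n: it sets the component along a unit vector n to t, and returns
    z when n = 0. *)
Definition regauss (n : 'I_d -> R) (p : d.-tuple R * R) : d.-tuple R :=
  tshift (fun i => (p.2 - tdot n p.1) * n i)%R p.1.

Lemma measurable_regauss (n : 'I_d -> R) : measurable_fun setT (regauss n).
Proof.
apply: (@measurable_tshift R d _ _ (fun p : d.-tuple R * R => p.1)
  (fun i (p : d.-tuple R * R) => (p.2 - tdot n p.1) * n i)%R); first exact: measurable_fst.
move=> i; apply: measurable_funM => //; apply: measurable_funB => //.
exact: (measurableT_comp (measurable_tdot n)).
Qed.

(** When Omega x = 0 the normalised direction is 0 rather than a unit vector, and this degenerate
    case has to be carried through. *)
Lemma nvec_dichotomy (Om : 'M[R]_d) (x : 'rV[R]_d) :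
  let n := nvec_coord Om x in
  ((x *m Om = 0)%R /\ n = (fun=> 0%R)) \/ ((x *m Om != 0)%R /\ (\sum_(i < d) n i ^+ 2 = 1)%R).
Proof.
have [x0|x0] := eqVneq (x *m Om)%R 0%R; [left|right]; split => //; last exact: sqr_nvec.
by apply/funext => i; rewrite /nvec_coord nvec0// mxE.
Qed.

Lemma tshift0 (z : d.-tuple R) : tshift (fun=> 0%R) z = z.
Proof. by apply: eq_from_tnth => i; rewrite tnth_mktuple addr0. Qed.

Lemma ge0_integral_regauss (Om : 'M[R]_d) (x : 'rV[R]_d) (f : d.-tuple R -> \bar R) :
  measurable_fun setT f -> (forall z, 0 <= f z) ->
  \int[gauss d \x gamma]_p f (regauss (nvec_coord Om x) p) = \int[gauss d]_z f z.
Proof.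
move=> mf f0; rewrite fubini_tonelli1//; last exact: (measurableT_comp mf (measurable_regauss _)).
have [[_ ->]|[_ n1]] := nvec_dichotomy Om x; last exact: (gauss_replace_direction n1 mf f0).
apply: eq_integral => z _; rewrite /fubini_F /regauss/=.
rewrite (eq_integral (fun=> f z)); first exact: integral_probability_cst.
move=> t _; congr f; rewrite -[RHS]tshift0; congr tshift.
by apply/funext => i; rewrite mulr0.
Qed.

End GCRN.

Section GCRNCoupling.
Context {R : realType} {d : nat}.
Local Notation gamma := (stdnormal R).
Local Notation gauss := (gauss R).
Local Open Scope ereal_scope.
Variables (Om : 'M[R]_d) (x y : 'rV[R]_d) (c : coupling R d).
Let P := cp_P c.
Variables (U : cp_T c -> R) (Z : cp_T c -> d.-tuple R) (Z1 : cp_T c -> R).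
Hypotheses (uU : unif01_law P U) (gZ : std_gauss_law P Z) (nZ1 : std_normal_law P Z1).
Hypothesis ind : forall (A : set R) (B : set (d.-tuple R)) (C : set R),
  measurable A -> measurable B -> measurable C ->
  P (U @^-1` A `&` Z @^-1` B `&` Z1 @^-1` C) =
  P (U @^-1` A) * P (Z @^-1` B) * P (Z1 @^-1` C).
Hypothesis cE : forall w, [/\ cp_Ux c w = U w, cp_Uy c w = U w,
  rowt (cp_Zx c w) = (rowt (Z w) - dotv (nvec Om x) (rowt (Z w)) *: nvec Om x
                           + Z1 w *: nvec Om x)%R &
  rowt (cp_Zy c w) = (rowt (Z w) - dotv (nvec Om y) (rowt (Z w)) *: nvec Om y
                           + Z1 w *: nvec Om y)%R].

Let W w := (Z w, Z1 w).

Let rowt_regauss u w : rowt (regauss (nvec_coord Om u) (W w)) =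
  (rowt (Z w) - dotv (nvec Om u) (rowt (Z w)) *: nvec Om u + Z1 w *: nvec Om u)%R.
Proof.
apply/rowP => i; rewrite !mxE tnth_mktuple dotv_rowt /=.
by rewrite -/(nvec_coord Om u) /nvec_coord !mxE; ring.
Qed.

Lemma gcrn_Zx w : cp_Zx c w = regauss (nvec_coord Om x) (W w).
Proof. by apply: rowt_inj; rewrite rowt_regauss; case: (cE w). Qed.

Lemma gcrn_Zy w : cp_Zy c w = regauss (nvec_coord Om y) (W w).
Proof. by apply: rowt_inj; rewrite rowt_regauss; case: (cE w). Qed.

Let mW : measurable_fun setT W.
Proof. by apply: measurable_fun_pair; [exact: gZ.1|exact: nZ1.1]. Qed.

Let PZ1 A : measurable A -> P (Z1 @^-1` A) = gamma A.
Proof. by move=> mA; rewrite nZ1.2. Qed.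

Let PW X : measurable X -> P (W @^-1` X) = (gauss d \x gamma) X.
Proof. exact: (pair_law_prod gZ.1 nZ1.1 (std_gauss_law_gauss gZ) PZ1 ind). Qed.

Let indW A X : measurable A -> measurable X ->
  P (U @^-1` A `&` W @^-1` X) = P (U @^-1` A) * P (W @^-1` X).
Proof. exact: (indep_pair uU.1 gZ.1 nZ1.1 ind). Qed.

Let ge0_integral_W (f : d.-tuple R * R -> \bar R) :
  measurable_fun setT f -> (forall p, 0 <= f p) ->
  \int[P]_w f (W w) = \int[gauss d \x gamma]_p f p.
Proof. exact: (eq_integral_law mW PW). Qed.

Let std_gauss_regauss u : std_gauss_law P (fun w => regauss (nvec_coord Om u) (W w)).
Proof.
have mr : measurable_fun setT (fun w => regauss (nvec_coord Om u) (W w)).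
  exact: (measurableT_comp (measurable_regauss _) mW).
split => // A mA; set B := [set z | _].
have mB : measurable B by exact: measurable_box.
have m1 : measurable_fun setT (fun z : d.-tuple R => (\1_B z)%:E : \bar R).
  by apply/measurable_EFinP; exact: measurable_indic.
have i0 z : 0 <= (\1_B z)%:E :> \bar R by rewrite lee_fin.
transitivity (\int[P]_w (\1_B (regauss (nvec_coord Om u) (W w)))%:E).
  rewrite -[X in P X]setIT -integral_indic//.
  by rewrite -[X in measurable X]setTI; exact: mr.
rewrite (ge0_integral_W (f := fun p => (\1_B (regauss (nvec_coord Om u) p))%:E))//; last first.
  exact: (measurableT_comp m1 (measurable_regauss _)).
rewrite (ge0_integral_regauss Om u m1 i0) integral_indic// setIT.
exact: gauss_box.
Qed.

(** Both proposals are functions of the pair (Z, Z1), which is independent of U; every independence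
    clause is a preimage of that fact, the joint one through the diagonal u -> (u, u). *)
Lemma gcrn_in_I : in_I c.
Proof.
have EUx : cp_Ux c = U by apply/funext => w; case: (cE w).
have EUy : cp_Uy c = U by apply/funext => w; case: (cE w).
have EZx : cp_Zx c = fun w => regauss (nvec_coord Om x) (W w).
  by apply/funext => w; exact: gcrn_Zx.
have EZy : cp_Zy c = fun w => regauss (nvec_coord Om y) (W w).
  by apply/funext => w; exact: gcrn_Zy.
have mpre d1 (T1 : measurableType d1) (f : d.-tuple R * R -> T1) B :
    measurable_fun setT f -> measurable B -> measurable (f @^-1` B).
  by move=> mf mB; rewrite -[X in measurable X]setTI; exact: mf.
rewrite /in_I EUx EUy EZx EZy; split=> //; split=> //; split; first exact: std_gauss_regauss.
split; first exact: std_gauss_regauss.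
split; [|split].
- move=> A B mA mB.
  by apply: (indW mA (X := regauss (nvec_coord Om x) @^-1` B)); apply: mpre => //;
    exact: measurable_regauss.
- move=> A B mA mB.
  by apply: (indW mA (X := regauss (nvec_coord Om y) @^-1` B)); apply: mpre => //;
    exact: measurable_regauss.
- move=> A B mA mB.
  apply: (indW (A := (fun u => (u, u)) @^-1` A)
    (X := (fun p => (regauss (nvec_coord Om x) p, regauss (nvec_coord Om y) p)) @^-1` B)).
    have muu : measurable_fun setT (fun u : R => (u, u)) by exact: measurable_fun_pair.
    by rewrite -[X in measurable X]setTI; exact: muu.
  by apply: mpre => //; apply: measurable_fun_pair; exact: measurable_regauss.
Qed.

(** As - Omega u = |Omega u| n, the linear term only sees the component along n, which is [Z1].
    Hence the same normal variable drives both acceptance ratios. *)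
Let regauss_logacc u (h : R) w :
  logacc Om h u (regauss (nvec_coord Om u) (W w)) =
  (h * enorm (u *m Om) * Z1 w -
   h ^+ 2 * sqn Om (rowt (regauss (nvec_coord Om u) (W w))) / 2)%R.
Proof.
rewrite /logacc bilE; congr (_ - _)%R.
have [[u0 _]|[u0 n1]] := nvec_dichotomy Om u.
  have -> : enorm (u *m Om) = 0%R by apply/eqP; rewrite enorm_eq0 u0.
  by rewrite mulr0 mul0r u0 dotvE big1 ?mulr0 ?oppr0// => i _; rewrite mxE mul0r.
have e0 : enorm (u *m Om) != 0%R by rewrite enorm_eq0.
have t1 : tdot (nvec_coord Om u) (regauss (nvec_coord Om u) (W w)) = Z1 w.
  by rewrite /regauss tdot_tshift//= addrC subrK.
rewrite -mulrN -[RHS]mulrA; congr (_ * _)%R; rewrite -[in RHS]t1 dotv_rowt /tdot.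
rewrite mulr_sumr -sumrN; apply: eq_bigr => i _.
by rewrite /nvec_coord nvecE mulNr mulrN !mulrA divff// mul1r.
Qed.

(** An inequality because a zero direction gives 0 on the left. *)
Let moment_nvec u :
  \int[P]_w (tdot (nvec_coord Om u) (Z w) ^+ 2)%:E <= \int[gamma]_t (t ^+ 2)%:E.
Proof.
have [[_ n0]|[_ n1]] := nvec_dichotomy Om u.
  rewrite (eq_integral (fun=> 0)); last first.
    move=> w _; rewrite n0 /tdot big1 ?expr0n// => i _; exact: mul0r.
  by rewrite integral0; apply: integral_ge0 => t _; rewrite lee_fin sqr_ge0.
have m2 : measurable_fun setT (fun t : R => (t ^+ 2)%:E : \bar R).
  by apply/measurable_EFinP; exact: exprn_measurable.
rewrite (ge0_integral_std_gauss_tdot gZ n1 m2)// => t.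
by rewrite lee_fin sqr_ge0.
Qed.

Let sum_sqr_nvec u : (\sum_(i < d) nvec_coord Om u i ^+ 2 <= 1)%R.
Proof.
have [[_ ->]|[_ ->]] // := nvec_dichotomy Om u.
by rewrite big1// => i _; rewrite expr0n.
Qed.

(** The left side is |zx - zy|^2 / 2, and zx - zy = a n1 - b n2 with n1, n2 of length at most 1. It
    is thus at most a^2 + b^2, and (s - t)^2 <= 2 s^2 + 2 t^2 gives the constants; the dimension
    does not appear. *)
Let dist_regauss w zx zy :
  zx = rowt (regauss (nvec_coord Om x) (W w)) ->
  zy = rowt (regauss (nvec_coord Om y) (W w)) ->
  ((dotv zx zx + dotv zy zy) / 2 - dotv zx zy <=
   4 * Z1 w ^+ 2 + 2 * tdot (nvec_coord Om x) (Z w) ^+ 2 +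
   2 * tdot (nvec_coord Om y) (Z w) ^+ 2)%R.
Proof.
move=> zxE zyE; pose n1 := nvec_coord Om x; pose n2 := nvec_coord Om y.
pose a := (Z1 w - tdot n1 (Z w))%R; pose b := (Z1 w - tdot n2 (Z w))%R.
have -> : ((dotv zx zx + dotv zy zy) / 2 - dotv zx zy =
    \sum_i (a * n1 i - b * n2 i) ^+ 2 / 2)%R.
  rewrite !dotvE -big_split/= mulr_suml -sumrB; apply: eq_bigr => i _.
  by rewrite zxE zyE !mxE /regauss !tnth_mktuple /= -/n1 -/n2 -/a -/b; field.
apply: (@le_trans _ _ (\sum_i (a ^+ 2 * n1 i ^+ 2 + b ^+ 2 * n2 i ^+ 2))%R).
  apply: ler_sum => i _; have := sqr_ge0 (a * n1 i + b * n2 i)%R; nra.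
rewrite big_split/= -!mulr_sumr.
have h1 := sum_sqr_nvec x; have h2 := sum_sqr_nvec y.
rewrite -/n1 -/n2 in h1 h2.
have ha : (a ^+ 2 * \sum_i n1 i ^+ 2 <= a ^+ 2)%R.
  by rewrite -[leRHS]mulr1 ler_wpM2l// sqr_ge0.
have hb : (b ^+ 2 * \sum_i n2 i ^+ 2 <= b ^+ 2)%R.
  by rewrite -[leRHS]mulr1 ler_wpM2l// sqr_ge0.
apply: (le_trans (lerD ha hb)); rewrite /a /b -/n1 -/n2.
have := sqr_ge0 (Z1 w + tdot n1 (Z w))%R; have := sqr_ge0 (Z1 w + tdot n2 (Z w))%R.
nra.
Qed.

(** Converse of the upper bound, with one extra term for the gap between inner product and norms;
    its 8 is 4 + 2 + 2 from [dist_regauss]. Finiteness of [err_norm] makes the error integrable, as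
    [integral_ge_perturb] requires. *)
Lemma gcrn_cross_expect_ge (h m k : R) : (0 <= h)%R -> (0 <= m)%R ->
  err_norm d h m < +oo ->
  m%:E * cap_mean (h * enorm (x *m Om)) (h * enorm (y *m Om)) k <=
  cross_expect Om h x y c +
  (err_norm d h m + err_norm d h m +
   (8 * h ^+ 2)%:E * \int[gamma]_t (t ^+ 2)%:E +
   m%:E * (err_quad Om h k + err_quad Om h k)).
Proof.
move=> h0 m0 finE.
have [_ [_ [gx [gy _]]]] := gcrn_in_I; have [mZx _] := gx; have [mZy _] := gy.
have mZ1 := nZ1.1; have mZ := gZ.1.
pose s1 := (h * enorm (x *m Om))%R; pose s2 := (h * enorm (y *m Om))%R.
pose k1 w := (h ^+ 2 * sqn Om (rowt (cp_Zx c w)) / 2)%R.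
pose k2 w := (h ^+ 2 * sqn Om (rowt (cp_Zy c w)) / 2)%R.
have mk1 : measurable_fun setT k1 by exact: measurable_quad.
have mk2 : measurable_fun setT k2 by exact: measurable_quad.
have lxE w : logacc Om h x (cp_Zx c w) = (s1 * Z1 w - k1 w)%R.
  by rewrite /k1 gcrn_Zx regauss_logacc.
have lyE w : logacc Om h y (cp_Zy c w) = (s2 * Z1 w - k2 w)%R.
  by rewrite /k2 gcrn_Zy regauss_logacc.
pose V w : R := expR (Num.min (s1 * Z1 w - k1 w)%R (s2 * Z1 w - k2 w)%R).
pose v (p : d.-tuple R * R) : R := expR (Num.min
  (s1 * p.2 - h ^+ 2 * sqn Om (rowt (regauss (nvec_coord Om x) p)) / 2)%R
  (s2 * p.2 - h ^+ 2 * sqn Om (rowt (regauss (nvec_coord Om y) p)) / 2)%R).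
have VE : V = v \o W.
  by apply/funext => w; rewrite /V /v /k1 /k2 gcrn_Zx gcrn_Zy.
have mv : measurable_fun setT v.
  by apply: measurableT_comp => //; apply: measurable_minr; apply: measurable_funB;
    [exact: measurable_funM|apply: measurable_quad; exact: measurable_regauss|
     exact: measurable_funM|apply: measurable_quad; exact: measurable_regauss].
have mV : measurable_fun setT V by rewrite VE; exact: (measurableT_comp mv mW).
have V0 w : (0 <= V w)%R by exact: expR_ge0.
(* With a common uniform, both proposals are accepted exactly when [U] is at most the smaller ratio,
   so [B] is the product of the two indicators. *)
pose B w : R := if (U w <= V w)%R then 1%R else 0%R.
have B0 w : (0 <= B w)%R by rewrite /B; case: ifP.
have mB : measurable_fun setT B.
  by apply: measurable_fun_ifT => //; apply: measurable_fun_ler => //; exact: uU.1.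
have EB : \int[P]_w (B w)%:E = \int[P]_w (Num.min 1 (V w))%:E.
  apply: uniform_le_indep => // A C mA mC; rewrite VE.
  apply: (indW mA (X := v @^-1` C)).
  by rewrite -[X in measurable X]setTI; exact: mv.
have capB : cap_mean s1 s2 k <= \int[P]_w (B w)%:E + (err_quad Om h k + err_quad Om h k).
  have [_] := integral_cap_perturb P s1 s2 k mZ1 mZ1 mk1 mk2.
  rewrite (integral_err_quad Om h k gx) (integral_err_quad Om h k gy) EB.
  apply: le_trans; rewrite le_eqVlt; apply/orP; left; apply/eqP/esym.
  apply: (eq_integral_law (f := fun t => (cap_exp s1 s2 k t t)%:E)) => //.
    by apply/measurable_EFinP; exact: measurable_cap_exp.
  by move=> t; rewrite lee_fin cap_exp_ge0.
pose ex w := `|h ^+ 2 * dotv (rowt (cp_Zx c w)) (rowt (cp_Zx c w)) - m|%R.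
pose ey w := `|h ^+ 2 * dotv (rowt (cp_Zy c w)) (rowt (cp_Zy c w)) - m|%R.
pose t0 w := (Z1 w ^+ 2)%R.
pose t1 w := (tdot (nvec_coord Om x) (Z w) ^+ 2)%R.
pose t2 w := (tdot (nvec_coord Om y) (Z w) ^+ 2)%R.
pose q w := (4 * t0 w + 2 * t1 w + 2 * t2 w)%R.
have mex : measurable_fun setT ex.
  apply: measurableT_comp => //; apply: measurable_funB => //.
  by apply: measurable_funM => //; exact: measurable_dotv.
have mey : measurable_fun setT ey.
  apply: measurableT_comp => //; apply: measurable_funB => //.
  by apply: measurable_funM => //; exact: measurable_dotv.
have mt1 : measurable_fun setT t1.
  by apply: measurable_funX; exact: (measurableT_comp (measurable_tdot _) mZ).
have mt2 : measurable_fun setT t2.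
  by apply: measurable_funX; exact: (measurableT_comp (measurable_tdot _) mZ).
have mz2 : measurable_fun setT t0 by exact: measurable_funX.
have mq : measurable_fun setT q.
  by apply: measurable_funD; first apply: measurable_funD; exact: measurable_funM.
have t10 w : (0 <= t1 w)%R by exact: sqr_ge0.
have t20 w : (0 <= t2 w)%R by exact: sqr_ge0.
have z20 w : (0 <= t0 w)%R by exact: sqr_ge0.
have q0 w : (0 <= q w)%R.
  by rewrite /q; apply: addr_ge0; first apply: addr_ge0; exact: mulr_ge0.
have ex0 w : (0 <= ex w)%R by exact: normr_ge0.
have ey0 w : (0 <= ey w)%R by exact: normr_ge0.
set M2 := \int[gamma]_t (t ^+ 2)%:E.
have M2fin : M2 \is a fin_num.
  rewrite ge0_fin_numE ?normal01_moment2//.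
  by apply: integral_ge0 => t _; rewrite lee_fin sqr_ge0.
have m2R : measurable_fun setT (fun t : R => (t ^+ 2)%:E : \bar R).
  by apply/measurable_EFinP; exact: exprn_measurable.
have Iq : \int[P]_w (q w)%:E <= 8%:E * M2.
  have mzE : measurable_fun setT (fun w => (t0 w)%:E) by exact/measurable_EFinP.
  have mt1E : measurable_fun setT (fun w => (t1 w)%:E) by exact/measurable_EFinP.
  have mt2E : measurable_fun setT (fun w => (t2 w)%:E) by exact/measurable_EFinP.
  have zE0 w : 0 <= (t0 w)%:E by rewrite lee_fin.
  have t1E0 w : 0 <= (t1 w)%:E by rewrite lee_fin.
  have t2E0 w : 0 <= (t2 w)%:E by rewrite lee_fin.
  rewrite (eq_integral (fun w =>
    4%:E * (t0 w)%:E + 2%:E * (t1 w)%:E + 2%:E * (t2 w)%:E)); last first.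
    by move=> w _.
  rewrite ge0_integralD//; last 4 first.
  - by move=> w _; apply: adde_ge0; apply: mule_ge0; rewrite ?lee_fin.
  - by apply: emeasurable_funD; exact: measurable_funeM.
  - by move=> w _; apply: mule_ge0; rewrite ?lee_fin.
  - exact: measurable_funeM.
  rewrite ge0_integralD//; last 4 first.
  - by move=> w _; apply: mule_ge0; rewrite ?lee_fin.
  - exact: measurable_funeM.
  - by move=> w _; apply: mule_ge0; rewrite ?lee_fin.
  - exact: measurable_funeM.
  rewrite !ge0_integralZl_EFin//.
  rewrite (_ : 8%:E * M2 = 4%:E * M2 + 2%:E * M2 + 2%:E * M2); last first.
    by rewrite -(fineK M2fin) -!EFinM -!EFinD; congr EFin; ring.
  apply: leeD; first apply: leeD; apply: lee_wpmul2l; rewrite ?lee_fin//.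
  - rewrite le_eqVlt; apply/orP; left; apply/eqP.
    have sq0 (t : R) : 0 <= (t ^+ 2)%:E by rewrite lee_fin sqr_ge0.
    exact: (eq_integral_law mZ1 PZ1 m2R sq0).
  - exact: moment_nvec.
  - exact: moment_nvec.
(* Pointwise deficit: on acceptance h^2 Zx.Zy >= m - (ex + ey) / 2 - h^2 q, the last term accounting
   for the distance between the proposals. *)
pose e w := (ex w + ey w + h ^+ 2 * q w)%R.
have Ie : \int[P]_w (e w)%:E <= err_norm d h m + err_norm d h m + (8 * h ^+ 2)%:E * M2.
  have mexE : measurable_fun setT (fun w => (ex w)%:E) by exact/measurable_EFinP.
  have meyE : measurable_fun setT (fun w => (ey w)%:E) by exact/measurable_EFinP.
  have mqE : measurable_fun setT (fun w => (q w)%:E) by exact/measurable_EFinP.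
  rewrite (eq_integral (fun w => (ex w)%:E + (ey w)%:E + (h ^+ 2)%:E * (q w)%:E)); last first.
    by move=> w _.
  rewrite ge0_integralD//; last 4 first.
  - by move=> w _; rewrite adde_ge0// lee_fin.
  - exact: emeasurable_funD.
  - by move=> w _; rewrite mule_ge0// lee_fin ?sqr_ge0.
  - exact: measurable_funeM.
  rewrite ge0_integralD//; last 2 first.
  - by move=> w _; rewrite lee_fin.
  - by move=> w _; rewrite lee_fin.
  rewrite (integral_err_norm h m gx) (integral_err_norm h m gy).
  apply: leeD => //; rewrite ge0_integralZl_EFin ?sqr_ge0//; last first.
    by move=> w _; rewrite lee_fin.
  have -> : (8 * h ^+ 2)%:E * M2 = (h ^+ 2)%:E * (8%:E * M2) by rewrite muleA -EFinM mulrC.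
  by apply: lee_wpmul2l => //; rewrite lee_fin sqr_ge0.
have eoo : \int[P]_w (e w)%:E < +oo.
  apply: (le_lt_trans Ie); apply: lte_add_pinfty; first exact: lte_add_pinfty.
  by rewrite -(fineK M2fin) -EFinM ltry.
have key : m%:E * \int[P]_w (B w)%:E <=
    cross_expect Om h x y c + \int[P]_w (e w)%:E.
  rewrite -ge0_integralZl_EFin//; last 2 first.
  - by move=> w _; rewrite lee_fin.
  - exact/measurable_EFinP.
  have [max may] := in_I_measurable_accept Om h x y gcrn_in_I.
  apply: (@integral_ge_perturb _ _ _ P _ (fun w => m * B w)%R e) => //.
  - apply: measurable_funM => //; apply: measurable_funM => //.
    by apply: measurable_funM => //; exact: measurable_dotv.
  - exact: measurable_funM.
  - by apply: measurable_funD; [exact: measurable_funD|exact: measurable_funM].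
  - by move=> w; rewrite mulr_ge0.
  - by move=> w; rewrite /e !addr_ge0// mulr_ge0// sqr_ge0.
  move=> w; rewrite -(mulrA _ (accept _ _ _ _ _)).
  have -> : (accept Om h x (cp_Ux c w) (cp_Zx c w) *
             accept Om h y (cp_Uy c w) (cp_Zy c w) = B w)%R.
    have [-> -> _ _] := cE w; rewrite !acceptE lxE lyE /B /V.
    have minE (a b : R) : expR (Num.min a b) = Num.min (expR a) (expR b).
      by rewrite /Num.min ltr_expR; case: ifP.
    by rewrite minE le_min; do 2 case: ifP => _; rewrite ?mulr0 ?mul0r ?mulr1.
  have D := dist_regauss (congr1 (@rowt R d) (gcrn_Zx w)) (congr1 (@rowt R d) (gcrn_Zy w)).
  have n1 := ler_norm (m - h ^+ 2 * dotv (rowt (cp_Zx c w)) (rowt (cp_Zx c w)))%R.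
  have n2 := ler_norm (m - h ^+ 2 * dotv (rowt (cp_Zy c w)) (rowt (cp_Zy c w)))%R.
  rewrite distrC -/(ex w) in n1; rewrite distrC -/(ey w) in n2.
  have D' := ler_wpM2l (sqr_ge0 h) D; rewrite -/(t0 w) -/(t1 w) -/(t2 w) -/(q w) in D'.
  have := ex0 w; have := ey0 w; have := mulr_ge0 (sqr_ge0 h) (q0 w).
  rewrite /B /e; case: ifP => _; rewrite ?mulr0 ?mulr1; first by lra.
  by move=> *; rewrite add0r !addr_ge0.
apply: (@le_trans _ _ (m%:E * (\int[P]_w (B w)%:E + (err_quad Om h k + err_quad Om h k)))).
  by apply: lee_wpmul2l => //; rewrite lee_fin.
have qq0 : 0 <= err_quad Om h k by apply: integral_ge0 => z _; rewrite lee_fin.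
have IB0 : 0 <= \int[P]_w (B w)%:E by apply: integral_ge0 => w _; rewrite lee_fin.
rewrite ge0_muleDr; [|exact: IB0|exact: adde_ge0].
rewrite [leRHS]addeA; apply: leeD => //; apply: (le_trans key).
exact: leeD.
Qed.

End GCRNCoupling.

Lemma is_GCRN_in_I (R : realType) d (Om : 'M[R]_d) (x y : 'rV[R]_d) (c : coupling R d) :
  is_GCRN Om x y c -> in_I c.
Proof.
move=> [U [Z [Z1 [uU gZ nZ1 ind cE]]]]; exact: (gcrn_in_I uU gZ nZ1 ind cE).
Qed.

(** * Construction of a GCRN coupling *)

Section Existence.
Context {R : realType} {d : nat}.
Local Notation gamma := (stdnormal R).
Local Notation gauss := (gauss R).
Local Open Scope ereal_scope.

Definition stduniform : probability R R :=
  image_law (uniform_prob (@ltr01 R)) (@measurable_measurableTypeR R).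

Definition gcrn_prob : probability (R * (d.-tuple R * R))%type R :=
  (stduniform \x (gauss d \x gamma))%E.

Definition gcrn (Om : 'M[R]_d) (x y : 'rV[R]_d) : coupling R d :=
  @Coupling R d _ _ gcrn_prob fst fst
    (fun w => regauss (nvec_coord Om x) w.2) (fun w => regauss (nvec_coord Om y) w.2).

Let QE (A : set R) (B : set (d.-tuple R)) (C : set R) :
  measurable A -> measurable B -> measurable C ->
  gcrn_prob (A `*` (B `*` C)) = stduniform A * gauss d B * gamma C.
Proof.
move=> mA mB mC; rewrite [LHS]product_measure1E//; last exact: measurableX.
by rewrite -muleA; congr (_ * _); rewrite [LHS]product_measure1E.
Qed.

(** Ensures that the supremum ranges over at least one GCRN coupling, which supplies its lower
    bound. *)
Lemma gcrn_is_GCRN (Om : 'M[R]_d) (x y : 'rV[R]_d) : is_GCRN Om x y (gcrn Om x y).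
Proof.
have g1 := probability_setT (gauss d); have u1 := probability_setT stduniform.
have n1 := probability_setT gamma.
have QU A : measurable A -> gcrn_prob (fst @^-1` A) = stduniform A.
  move=> mA; have := QE mA measurableT measurableT; rewrite g1 n1 !mule1 => <-.
  by congr (gcrn_prob _); apply/seteqP; split => -[u [z t]]//= [].
have QZ B : measurable B -> gcrn_prob ((fun w => w.2.1) @^-1` B) = gauss d B.
  move=> mB; have := QE measurableT mB measurableT; rewrite u1 n1 mul1e mule1 => <-.
  by congr (gcrn_prob _); apply/seteqP; split => -[u [z t]]//= [_ []].
have QZ1 C : measurable C -> gcrn_prob ((fun w => w.2.2) @^-1` C) = gamma C.
  move=> mC; have := QE measurableT measurableT mC; rewrite u1 g1 !mul1e => <-.
  by congr (gcrn_prob _); apply/seteqP; split => -[u [z t]]//= [_ []].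
exists fst, (fun w => w.2.1), (fun w => w.2.2); split.
- by split => // A mA; rewrite [LHS]QU.
- split; first exact: (measurableT_comp measurable_fst).
  by move=> A mA; rewrite [LHS]QZ ?gauss_box//; exact: measurable_box.
- split; first exact: (measurableT_comp measurable_snd).
  by move=> A mA; rewrite [LHS]QZ1.
- move=> A B C mA mB mC.
  transitivity (gcrn_prob (A `*` (B `*` C))).
    by congr (gcrn_prob _); apply/seteqP; split => -[u [z t]] /= [] => [[]|? []].
  by rewrite (QE mA mB mC) -(QU _ mA) -(QZ _ mB) -(QZ1 _ mC).
- move=> w; split => //.
    apply/rowP => i; rewrite !mxE tnth_mktuple dotv_rowt /=.
    by rewrite -/(nvec_coord Om x) /nvec_coord !mxE; ring.
  apply/rowP => i; rewrite !mxE tnth_mktuple dotv_rowt /=.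
  by rewrite -/(nvec_coord Om y) /nvec_coord !mxE; ring.
Qed.

End Existence.

(** * High-dimensional limit *)

Section Limits.
Context {R : realType}.
Local Notation gauss := (gauss R).
Local Open Scope ereal_scope.

Lemma cvge_near_le (f : nat -> \bar R) (L : R) :
  (forall e : R, (0 < e)%R ->
     \forall n \near \oo, (L - e)%:E <= f n /\ f n <= (L + e)%:E) ->
  f @ \oo --> L%:E.
Proof.
move=> H; apply/fine_cvgP; split.
  near=> n; have [h1 h2] : (L - 1)%:E <= f n /\ f n <= (L + 1)%:E by near: n; exact: H.
  by rewrite fin_numElt (lt_le_trans (ltNyr _) h1) (le_lt_trans h2 (ltry _)).
apply/cvgrPdist_le => e e0; near=> n.
have [h1 h2] : (L - e)%:E <= f n /\ f n <= (L + e)%:E by near: n; exact: H.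
move: h1 h2; rewrite [(_ \o _) n]/=; case: (f n) => [r| |] //=.
by rewrite !lee_fin => h1 h2; rewrite ler_norml; apply/andP; split; lra.
Unshelve. all: by end_near.
Qed.

Lemma cvge0_near_le (f : nat -> \bar R) (e : R) :
  f @ \oo --> 0 -> (0 < e)%R -> \forall n \near \oo, f n <= e%:E.
Proof.
move=> /fine_cvgP[ffin /cvgrPdist_le fcvg] e0; near=> n.
have fn : f n \is a fin_num by near: n.
have : (`|0 - fine (f n)| <= e)%R by near: n; exact: fcvg.
rewrite sub0r normrN => /(le_trans (ler_norm _)); rewrite -lee_fin fineK//.
Unshelve. all: by end_near.
Qed.

(** The L2 convergence is applied on the canonical space and weakened to L1, the norm in which the
    errors are expressed. *)
Lemma assumption_z_L1 (Om : forall d, 'M[R]_d) (z : int -> R) (k : int) (e : R) :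
  assumption_z Om z -> (0 < e)%R ->
  \forall d \near \oo,
    \int[gauss d]_w `|sqn (mpowz (Om d) k) (rowt w) / d%:R - z k ^+ 2|%:E <= e%:E.
Proof.
move=> /(_ k)[_ Hz] e0.
have {Hz} := Hz (fun d => @GVec R d _ _ (gauss d) id) (@gauss_std_gauss_law R).
(* This threshold yields e / 2 + (e^2 / 4) / e = 3 e / 4 in the end. *)
have e20 : (0 < e ^+ 2 / 4)%R by rewrite divr_gt0// exprn_gt0.
move=> /cvge0_near_le/(_ e20); apply: filterS => d /= Hd.
pose X (w : d.-tuple R) := (sqn (mpowz (Om d) k) (rowt w) / d%:R - z k ^+ 2)%R.
have mX : measurable_fun setT X.
  by apply: measurable_funB => //; apply: measurable_funM => //; exact: measurable_sqn.
have mX2 : measurable_fun setT (fun w => (X w ^+ 2)%:E).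
  by apply/measurable_EFinP; exact: measurable_funX.
have sq0 w : 0 <= (X w ^+ 2)%:E by rewrite lee_fin sqr_ge0.
have ei0 : (0 <= e^-1)%R by rewrite invr_ge0 ltW.
apply: (@le_trans _ _ (\int[gauss d]_w ((e / 2)%:E + (e^-1)%:E * (X w ^+ 2)%:E))).
  apply: ge0_le_integral => //.
  - apply/measurable_EFinP; exact: measurableT_comp.
  - by apply: emeasurable_funD => //; exact: measurable_funeM.
  - move=> w _; rewrite -EFinM -EFinD lee_fin -/(X w) -(real_normK (num_real (X w))).
    (* AM-GM: |X| <= e/2 + X^2/(2e) *)
    have := normr_ge0 (X w); set a := `|X w|%R => a0.
    rewrite -(ler_pM2l e0) mulrDr mulrA mulfV ?gt_eqF// mul1r.
    have := sqr_ge0 (a - e)%R; have := sqr_ge0 a; nra.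
rewrite ge0_integralD//; last 3 first.
- by move=> w _; rewrite lee_fin divr_ge0// ltW.
- by move=> w _; apply: mule_ge0; [rewrite lee_fin|exact: sq0].
- exact: measurable_funeM.
rewrite integral_probability_cst ge0_integralZl_EFin//.
apply: (@le_trans _ _ ((e / 2)%:E + (e^-1)%:E * (e ^+ 2 / 4)%:E)).
  by apply: leeD => //; apply: lee_wpmul2l; rewrite ?lee_fin.
rewrite -EFinM -EFinD lee_fin.
have -> : (e / 2 + e^-1 * (e ^+ 2 / 4) = e * (3 / 4))%R by field; rewrite gt_eqF.
by nra.
Qed.

End Limits.

(** * Scaling h = l / sqrt d and errors uniform over couplings *)

Section Step.
Context {R : realType}.
Local Notation gauss := (gauss R).
Local Open Scope ereal_scope.

(** With h^2 = l^2 / d, and |Z|^2 read as the norm for Omega^0, the error becomes the quantity that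
    the assumption controls at exponent 0. *)
Lemma err_norm_scaled d (Om : 'M[R]_d) (l z0 : R) : (0 < d)%N ->
  err_norm d (l / Num.sqrt d%:R) (l ^+ 2 * z0 ^+ 2) =
  (l ^+ 2)%:E * \int[gauss d]_w `|sqn (mpowz Om 0) (rowt w) / d%:R - z0 ^+ 2|%:E.
Proof.
move=> d0; have dR : (0 < d%:R :> R)%R by rewrite ltr0n.
rewrite -ge0_integralZl_EFin ?sqr_ge0//; last first.
  apply/measurable_EFinP; apply: measurableT_comp => //; apply: measurable_funB => //.
  by apply: measurable_funM => //; exact: measurable_sqn.
apply: eq_integral => w _; rewrite -EFinM; congr EFin.
rewrite -[X in (X * `|_|)%R](ger0_norm (sqr_ge0 l)) -normrM; congr `|_|%R.
rewrite dotv_rowt_self /= exprMn exprVn sqr_sqrtr ?ltW// mulrBr; congr (_ - _)%R.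
by field; rewrite gt_eqF.
Qed.

Lemma err_quad_scaled d (Om : 'M[R]_d) (l z1 : R) : (0 < d)%N ->
  err_quad Om (l / Num.sqrt d%:R) (l ^+ 2 * z1 ^+ 2 / 2) =
  (l ^+ 2 / 2)%:E * \int[gauss d]_w `|sqn (mpowz Om 1) (rowt w) / d%:R - z1 ^+ 2|%:E.
Proof.
move=> d0; have dR : (0 < d%:R :> R)%R by rewrite ltr0n.
have l20 : (0 <= l ^+ 2 / 2)%R by rewrite divr_ge0// sqr_ge0.
rewrite -ge0_integralZl_EFin//; last first.
  apply/measurable_EFinP; apply: measurableT_comp => //; apply: measurable_funB => //.
  by apply: measurable_funM => //; exact: measurable_sqn.
apply: eq_integral => w _; rewrite -EFinM; congr EFin.
rewrite -[X in (X * `|_|)%R](ger0_norm l20) -normrM; congr `|_|%R.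
rewrite /= mulmx1 exprMn exprVn sqr_sqrtr ?ltW//; field.
by rewrite gt_eqF.
Qed.

Lemma scaled_enorm d (Om : 'M[R]_d) (x : 'rV[R]_d) (l z1 a : R) : (0 < d)%N ->
  (0 < z1)%R -> Om^T%R = Om ->
  (sqn (Om *m Om) x / (z1 ^+ 2 * d%:R) = a)%R ->
  (l / Num.sqrt d%:R * enorm (x *m Om) = l * z1 * Num.sqrt a)%R.
Proof.
move=> d0 z10 Omt <-; have dR : (0 < d%:R :> R)%R by rewrite ltr0n.
rewrite sqn_mulmxx// -/(enorm _) sqrtrM ?dotv_ge0//.
rewrite sqrtrV ?mulr_ge0 ?sqr_ge0 ?ltW// sqrtrM ?sqr_ge0// sqrtr_sqr gtr0_norm//.
rewrite -/(enorm _); field; rewrite !gt_eqF// sqrtr_gt0//.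
Qed.

End Step.

Section StepBounds.
Context {R : realType} (d : nat).
Local Notation gamma := (stdnormal R).
Local Open Scope ereal_scope.
Variables (Om : 'M[R]_d) (x y : 'rV[R]_d) (h m k : R).
Hypotheses (d_gt0 : (0 < d)%N) (h_ge0 : (0 <= h)%R) (m_ge0 : (0 <= m)%R).

(** One error for both bounds, mentioning neither the states nor the coupling; this uniformity lets
    it pass through the supremum. *)
Definition step_err : \bar R :=
  err_norm d h m + err_norm d h m +
  (8 * h ^+ 2)%:E * \int[gamma]_t (t ^+ 2)%:E +
  m%:E * (err_quad Om h k + err_quad Om h k).

Let L := m%:E * cap_mean (h * enorm (x *m Om)) (h * enorm (y *m Om)) k.

Lemma in_I_cross_expect_le_step (c : coupling R d) : in_I c ->
  cross_expect Om h x y c <= L + step_err.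
Proof.
move=> cI; apply: (le_trans (in_I_cross_expect_le Om x y d_gt0 h_ge0 cI k m_ge0)).
apply: leeD => //; apply: leeD => //; rewrite -[leLHS]adde0; apply: leeD => //.
apply: mule_ge0; first by rewrite lee_fin mulr_ge0// sqr_ge0.
by apply: integral_ge0 => t _; rewrite lee_fin sqr_ge0.
Qed.

Lemma is_GCRN_cross_expect_ge_step (c : coupling R d) : is_GCRN Om x y c ->
  step_err < +oo -> L <= cross_expect Om h x y c + step_err.
Proof.
move=> [U [Z [Z1 [uU gZ nZ1 ind cE]]]] err_fin.
apply: (gcrn_cross_expect_ge uU gZ nZ1 ind cE) => //.
have n0 : 0 <= err_norm d h m by apply: integral_ge0 => w _; rewrite lee_fin.
have q0 : 0 <= err_quad Om h k by apply: integral_ge0 => w _; rewrite lee_fin.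
have A0 : 0 <= (8 * h ^+ 2)%:E * \int[gamma]_t (t ^+ 2)%:E.
  apply: mule_ge0; first by rewrite lee_fin mulr_ge0// sqr_ge0.
  by apply: integral_ge0 => t _; rewrite lee_fin sqr_ge0.
have B0 : 0 <= m%:E * (err_quad Om h k + err_quad Om h k).
  by apply: mule_ge0; [rewrite lee_fin|exact: adde_ge0].
have leS (u v w : \bar R) : 0 <= u -> 0 <= v -> 0 <= w -> u <= u + u + v + w.
  by move=> u0 v0 w0; rewrite -!addeA leeDl// !adde_ge0.
exact: le_lt_trans (leS _ _ _ n0 A0 B0) err_fin.
Qed.

End StepBounds.

Lemma step_err_near_le (R : realType) (Om : forall d, 'M[R]_d) (z : int -> R) (l e : R) :
  assumption_z Om z -> 0 < e ->
  \forall d \near \oo, (step_err (Om d) (l / Num.sqrt d%:R)%R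
    (l ^+ 2 * z 0 ^+ 2)%R (l ^+ 2 * z 1 ^+ 2 / 2)%R <= e%:E)%E.
Proof.
move=> Hz e0.
pose M2 : R := fine (\int[stdnormal R]_t (t ^+ 2)%:E).
have M2E : (\int[stdnormal R]_t (t ^+ 2)%:E = M2%:E)%E.
  rewrite fineK// ge0_fin_numE ?normal01_moment2//.
  by apply: integral_ge0 => t _; rewrite lee_fin sqr_ge0.
have M20 : 0 <= M2.
  by rewrite -lee_fin -M2E; apply: integral_ge0 => t _; rewrite lee_fin sqr_ge0.
have l20 : 0 <= l ^+ 2 by exact: sqr_ge0.
have m0 : 0 <= l ^+ 2 * z 0 ^+ 2 by rewrite mulr_ge0 ?sqr_ge0.
(* Total coefficient of the error once both L1 distances and 1 / d are at most a = e / K: the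
   summands come from the norm errors, the second moment and the quadratic errors, and the final 1
   keeps [K] positive. *)
pose K := 2 * l ^+ 2 + 8 * l ^+ 2 * M2 + l ^+ 2 * z 0 ^+ 2 * l ^+ 2 + 1.
have lM : 0 <= l ^+ 2 * M2 by exact: mulr_ge0.
have ml : 0 <= l ^+ 2 * z 0 ^+ 2 * l ^+ 2 by exact: mulr_ge0.
have K0 : 0 < K by rewrite /K; lra.
pose a := e / K; have a0 : 0 < a by rewrite divr_gt0.
near=> d.
have d0 : (0 < d)%N by near: d; exact: nbhs_infty_gt.
have dR : 0 < d%:R :> R by rewrite ltr0n.
have I0 : (\int[gauss R d]_w
    `|sqn (mpowz (Om d) 0%R) (rowt w) / d%:R - z 0%R ^+ 2|%:E <= a%:E)%E.
  by near: d; exact: assumption_z_L1.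
have I1 : (\int[gauss R d]_w
    `|sqn (mpowz (Om d) 1%R) (rowt w) / d%:R - z 1%R ^+ 2|%:E <= a%:E)%E.
  by near: d; exact: assumption_z_L1.
have da : d%:R^-1 <= a.
  rewrite -[a]invrK lef_pV2 ?posrE ?invr_gt0//.
  by near: d; exact: nbhs_infty_ger.
rewrite /step_err (err_norm_scaled (Om d))// err_quad_scaled// M2E.
apply: (@le_trans _ _ ((l ^+ 2)%:E * a%:E + (l ^+ 2)%:E * a%:E +
   (8 * (l / Num.sqrt d%:R) ^+ 2)%:E * M2%:E +
   (l ^+ 2 * z 0 ^+ 2)%:E * ((l ^+ 2 / 2)%:E * a%:E + (l ^+ 2 / 2)%:E * a%:E))%E).
  by apply: leeD; [apply: leeD => //; apply: leeD|apply: lee_wpmul2l; [|apply: leeD]];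
    rewrite ?lee_fin// lee_wpmul2l// lee_fin// divr_ge0.
rewrite -!EFinM -!EFinD lee_fin.
have -> : (l / Num.sqrt d%:R) ^+ 2 = l ^+ 2 * d%:R^-1.
  by rewrite exprMn exprVn sqr_sqrtr ?ltW.
have aK : a * K = e by rewrite /a mulfVK ?gt_eqF.
rewrite -aK /K.
have h1 : l ^+ 2 * M2 * d%:R^-1 <= l ^+ 2 * M2 * a by rewrite ler_wpM2l.
rewrite [leLHS](_ : _ = 2 * (l ^+ 2 * a) + 8 * (l ^+ 2 * M2 * d%:R^-1) +
  l ^+ 2 * z 0 ^+ 2 * l ^+ 2 * a); last by field; rewrite gt_eqF.
rewrite [leRHS](_ : _ = 2 * (l ^+ 2 * a) + 8 * (l ^+ 2 * M2 * a) +
  l ^+ 2 * z 0 ^+ 2 * l ^+ 2 * a + a); last by ring.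
lra.
Unshelve. all: by end_near.
Qed.

Theorem theorem4 (R : realType) (Sigma : forall d : nat, 'M[R]_d) (z : int -> R)
  (l x1 y1 v1 : R) :
  (forall d : nat, (0 < d)%N -> sym_pd (Sigma d)) ->
  assumption_z (fun d => invmx (Sigma d)) z ->
  0 < l ->
  in_S x1 y1 v1 ->
  let Om := fun d : nat => invmx (Sigma d) in
  let h := fun d : nat => l / Num.sqrt (d%:R) in
  exists L : R,
    forall x y : forall d : nat, 'rV[R]_d,
      (\forall d \near \oo,
         [/\ sqn (Om d *m Om d) (x d) / (z 1 ^+ 2 * d%:R) = x1,
             sqn (Om d *m Om d) (y d) / (z 1 ^+ 2 * d%:R) = y1 &
             bil (Om d *m Om d) (x d) (y d) / (z 1 ^+ 2 * d%:R) = v1]) ->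
      (forall c : forall d : nat, coupling R d,
         (forall d, is_GCRN (Om d) (x d) (y d) (c d)) ->
         (fun d => cross_expect (Om d) (h d) (x d) (y d) (c d)) @ \oo --> L%:E)
      /\ (fun d => sup_I (Om d) (h d) (x d) (y d)) @ \oo --> L%:E.
Proof.
move=> spd Hz l0 _ Om h.
have z10 : 0 < z 1 by case: (Hz 1).
pose m := l ^+ 2 * z 0 ^+ 2; pose k := l ^+ 2 * z 1 ^+ 2 / 2.
have m0 : 0 <= m by rewrite mulr_ge0 ?sqr_ge0.
pose C := cap_mean (l * z 1 * Num.sqrt x1) (l * z 1 * Num.sqrt y1) k.
have Cfin : C \is a fin_num.
  by rewrite ge0_fin_numE ?cap_mean_ge0// (le_lt_trans (cap_mean_le1 _ _ _)) ?ltry.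
exists (m * fine C) => x y Hxy.
have LE : (m * fine C)%:E = (m%:E * C)%E by rewrite EFinM fineK.
pose err d := step_err (Om d) (h d) m k.
(* The coupling is quantified after [near], so the threshold in d is the same for the whole
   class. *)
have up : \forall d \near \oo, forall c : coupling R d, in_I c ->
    (cross_expect (Om d) (h d) (x d) (y d) c <= (m * fine C)%:E + err d)%E.
  near=> d => c cI.
  have d0 : (0 < d)%N by near: d; exact: nbhs_infty_gt.
  have [ex ey _] : [/\ sqn (Om d *m Om d) (x d) / (z 1 ^+ 2 * d%:R) = x1,
             sqn (Om d *m Om d) (y d) / (z 1 ^+ 2 * d%:R) = y1 &
             bil (Om d *m Om d) (x d) (y d) / (z 1 ^+ 2 * d%:R) = v1] by near: d.
  have Omt : (Om d)^T = Om d by rewrite trmx_inv (spd d d0).1.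
  have h0 : 0 <= h d by rewrite divr_ge0 ?sqrtr_ge0// ltW.
  have := in_I_cross_expect_le_step (Om d) (x d) (y d) k d0 h0 m0 cI.
  by rewrite /h (scaled_enorm l d0 z10 Omt ex) (scaled_enorm l d0 z10 Omt ey) LE.
have lo : \forall d \near \oo, forall c : coupling R d, is_GCRN (Om d) (x d) (y d) c ->
    (err d < +oo -> (m * fine C)%:E <= cross_expect (Om d) (h d) (x d) (y d) c + err d)%E.
  near=> d => c cG errd.
  have d0 : (0 < d)%N by near: d; exact: nbhs_infty_gt.
  have [ex ey _] : [/\ sqn (Om d *m Om d) (x d) / (z 1 ^+ 2 * d%:R) = x1,
             sqn (Om d *m Om d) (y d) / (z 1 ^+ 2 * d%:R) = y1 &
             bil (Om d *m Om d) (x d) (y d) / (z 1 ^+ 2 * d%:R) = v1] by near: d.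
  have Omt : (Om d)^T = Om d by rewrite trmx_inv (spd d d0).1.
  have h0 : 0 <= h d by rewrite divr_ge0 ?sqrtr_ge0// ltW.
  have := is_GCRN_cross_expect_ge_step (k := k) h0 m0 cG errd.
  by rewrite /h (scaled_enorm l d0 z10 Omt ex) (scaled_enorm l d0 z10 Omt ey) LE.
have errE e : 0 < e -> \forall d \near \oo, (err d <= e%:E)%E.
  by move=> e0; exact: (step_err_near_le l Hz e0).
have upper e : 0 < e -> \forall d \near \oo, forall c : coupling R d, in_I c ->
    (cross_expect (Om d) (h d) (x d) (y d) c <= (m * fine C + e)%:E)%E.
  move=> e0; near=> d => c cI.
  have ed : (err d <= e%:E)%E by near: d; exact: errE.
  have U : (cross_expect (Om d) (h d) (x d) (y d) c <= (m * fine C)%:E + err d)%E.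
    by move: c cI; near: d; exact: up.
  by rewrite EFinD (le_trans U)// leeD2l.
have lower e : 0 < e -> \forall d \near \oo,
    forall c : coupling R d, is_GCRN (Om d) (x d) (y d) c ->
    ((m * fine C - e)%:E <= cross_expect (Om d) (h d) (x d) (y d) c)%E.
  move=> e0; near=> d => c cG.
  have ed : (err d <= e%:E)%E by near: d; exact: errE.
  have U : (err d < +oo ->
      (m * fine C)%:E <= cross_expect (Om d) (h d) (x d) (y d) c + err d)%E.
    by move: c cG; near: d; exact: lo.
  rewrite EFinB leeBlDr// (le_trans (U _))//; first by rewrite (le_lt_trans ed) ?ltry.
  by rewrite leeD2l.
split=> [c cG|]; apply: cvge_near_le => e e0; near=> d.
- split.
    have lo' : forall c : coupling R d, is_GCRN (Om d) (x d) (y d) c ->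
      ((m * fine C - e)%:E <= cross_expect (Om d) (h d) (x d) (y d) c)%E.
      by near: d; exact: lower.
    exact: lo'.
  have up' : forall c : coupling R d, in_I c ->
    (cross_expect (Om d) (h d) (x d) (y d) c <= (m * fine C + e)%:E)%E.
    by near: d; exact: upper.
  by apply: up'; exact: is_GCRN_in_I.
(* The supremum is squeezed between the value at the explicit GCRN coupling and the uniform upper
   bound. *)
- have G := gcrn_is_GCRN (Om d) (x d) (y d); split.
    have lo' : forall c : coupling R d, is_GCRN (Om d) (x d) (y d) c ->
      ((m * fine C - e)%:E <= cross_expect (Om d) (h d) (x d) (y d) c)%E.
      by near: d; exact: lower.
    apply: (le_trans (lo' _ G)); apply: ereal_sup_ubound.
    by exists (gcrn (Om d) (x d) (y d)); split => //; exact: is_GCRN_in_I G.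
  have up' : forall c : coupling R d, in_I c ->
    (cross_expect (Om d) (h d) (x d) (y d) c <= (m * fine C + e)%:E)%E.
    by near: d; exact: upper.
  by apply: ge_ereal_sup => _ [c [cI ->]]; exact: up'.
Unshelve. all: by end_near.
Qed.
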